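(* Assume in addition that $\Phi\in C^1([0,\infty))$. Let $\alpha>0$, $y_0\in BV(\mathbb R)$ with $y_0\ge1$, and let $w_\alpha$ be a bounded, Lipschitz continuous weak solution with values in $[1,\infty)$ of $\partial_t w_\alpha=\partial_z\overline{W(w_\alpha)}$, $w_\alpha(\cdot,0)=\overline{y_0}$. Let $\eta\in C^2$ be convex and $Q$ satisfy $Q'(w)=\eta'(w)W'(w)$. Then, in the sense of distributions (and a.e.), $$\partial_t\eta(w_\alpha(z,t))+D(z,t)=\partial_z\overline{Q(w_\alpha)}(z,t),$$ where $$D(z,t)=\int_0^\infty(-\Phi_\alpha')(\zeta)\int_{w_\alpha(z,t)}^{w_\alpha(z+\zeta,t)}\int_{w_\alpha(z,t)}^{\sigma}\eta''(\mu)\,W'(\sigma)\,d\mu\,d\sigma\,d\zeta\ \ge 0.$$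
   Context: Kernel: $\Phi:[0,\infty)\to[0,\infty)$ is non-increasing with $\int_0^\infty\Phi(z)\,dz=1$ and $\int_0^\infty z\Phi(z)\,dz<\infty$; for $\alpha>0$, $\Phi_\alpha(z)=\alpha^{-1}\Phi(z/\alpha)$, and for bounded measurable $h:\mathbb R\to\mathbb R$, $\overline h(z)=\int_0^\infty\Phi_\alpha(\zeta)h(z+\zeta)\,d\zeta$. Flux: $V\in C^1([0,\infty))$ is non-increasing and $W:[1,\infty)\to\mathbb R$, $W(w)=V(1/w)$ (non-decreasing). A weak solution of $\partial_t w=\partial_z\overline{W(w)}$ on $[0,T]$ with initial datum $w_0$ means $\int_0^T\!\int_{\mathbb R}w\partial_t\varphi-\overline{W(w)}\partial_z\varphi\,dz\,dt=\int_{\mathbb R}w(z,T)\varphi(z,T)-w_0(z)\varphi(z,0)\,dz$ for all $\varphi\in C_0^\infty(\mathbb R\times[0,T])$, for every $T>0$. *)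

(* Defs.v *)
From HB Require Import structures.
From mathcomp Require Import all_boot all_order all_algebra.
From mathcomp Require Import all_classical all_reals all_analysis.
Set Implicit Arguments. Unset Strict Implicit. Unset Printing Implicit Defensive.
Import Order.TTheory GRing.Theory Num.Theory.
Import numFieldNormedType.Exports.
Local Open Scope classical_set_scope.
Local Open Scope ring_scope.

Section Defs.
Variable R : realType.

Definition leb := (@lebesgue_measure R).

Definition oint (a b : R) (f : R -> R) : R :=
  if a <= b then Rintegral leb `[a, b] f else - Rintegral leb `[b, a] f.

Definition Phi_a (Phi : R -> R) (alpha : R) (z : R) : R := alpha^-1 * Phi (z / alpha).

Definition avg (Phi : R -> R) (alpha : R) (h : R -> R) (z : R) : R :=
  Rintegral leb `[0, +oo[ (fun zeta => Phi_a Phi alpha zeta * h (z + zeta)).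

Definition C1_nonneg (f : R -> R) : Prop :=
  {within `[0, +oo[, continuous f} /\
  exists f' : R -> R, {within `[0, +oo[, continuous f'} /\
    (forall x : R, 0 < x -> is_derive x (1 : R) f (f' x)) /\
    (fun h : R => h^-1 * (f h - f 0)) @ (0 : R)^'+ --> f' 0.

Definition C2 (f : R -> R) : Prop :=
  (forall x : R, derivable f x 1) /\ (forall x : R, derivable (derive1 f) x 1) /\
  continuous (derive1 (derive1 f)).

Definition BV (f : R -> R) : Prop :=
  exists C : R, forall a b, a <= b -> (total_variation a b f <= C%:E)%E.

Definition dz (f : R -> R -> R) : R -> R -> R :=
  fun z t => derive1 (fun x => f x t) z.
Definition dt (f : R -> R -> R) : R -> R -> R :=
  fun z t => derive1 (fun s => f z s) t.

Fixpoint dmix (l : seq bool) (f : R -> R -> R) : R -> R -> R :=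
  match l with
  | [::] => f
  | b :: l' => (if b then dz else dt) (dmix l' f)
  end.

Definition smooth2 (f : R -> R -> R) : Prop :=
  forall l : seq bool,
    continuous (fun p : R * R => dmix l f p.1 p.2) /\
    (forall z t, derivable (fun x => dmix l f x t) z 1 /\
                 derivable (fun s => dmix l f z s) t 1).

(* test functions in C_0^oo(R x [0,T]): smooth, support bounded in z *)
Definition test_fun (T : R) (phi : R -> R -> R) : Prop :=
  smooth2 phi /\ exists M : R, forall z t, M < `|z| -> phi z t = 0.

Definition test_fun_open (phi : R -> R -> R) : Prop :=
  smooth2 phi /\ exists M eps : R, 0 < eps /\
    forall z t, M < `|z| \/ t < eps \/ M < t -> phi z t = 0.

Definition weak_solution (Phi : R -> R) (alpha : R) (W : R -> R)
    (w : R -> R -> R) (w0 : R -> R) : Prop :=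
  forall T : R, 0 < T -> forall phi, test_fun T phi ->
    Rintegral leb `[0, T] (fun t => Rintegral leb setT (fun z =>
        w z t * dt phi z t - avg Phi alpha (fun x => W (w x t)) z * dz phi z t))
    = Rintegral leb setT (fun z => w z T * phi z T - w0 z * phi z 0).

Definition Dterm (Phi : R -> R) (alpha : R) (W eta : R -> R)
    (w : R -> R -> R) (z t : R) : R :=
  Rintegral leb `[0, +oo[ (fun zeta =>
    - derive1 (Phi_a Phi alpha) zeta *
      oint (w z t) (w (z + zeta) t) (fun sigma =>
        oint (w z t) sigma (fun mu => derive1 (derive1 eta) mu * derive1 W sigma))).

Definition Wof (V : R -> R) : R -> R := fun x => V (1 / x).

Definition convex_fun (f : R -> R) : Prop :=
  forall x y l : R, 0 <= l -> l <= 1 ->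
    f (l * x + (1 - l) * y) <= l * f x + (1 - l) * f y.

End Defs.

(* Main.v *)
Require Import Defs.
From HB Require Import structures.
From mathcomp Require Import all_boot all_order all_algebra.
From mathcomp Require Import all_classical all_reals all_analysis.
From mathcomp Require Import measurable_realfun ring lra.
Import Order.TTheory GRing.Theory Num.Theory.
Import numFieldNormedType.Exports.
Local Open Scope classical_set_scope.
Local Open Scope ring_scope.

(* For a bounded continuous [h], the average [z |-> \int_0^oo Phi_a(s) h(z+s) ds]
   is C^1 with derivative [\int_0^oo (-Phi_a')(s) (h(z+s) - h(z)) ds]. Hence, with
   [G_q(z,t) := \int_0^oo (-Phi_a')(s) (q(w(z+s,t)) - q(w(z,t))) ds], which is
   Lipschitz in [(z,t)] when [q] is Lipschitz on the range of [w], the weak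
   formulation says [w_t = G_W] in the sense of distributions; as [G_W] is
   continuous, the equation holds classically at every point with [t > 0]. The
   chain rule gives [eta(w)_t = eta'(w) G_W], while [d/dz avg(Q(w)) = G_Q], and
   integrating [eta''] and [W'] explicitly gives [D = G_Q - eta'(w) G_W]. So the
   entropy balance holds everywhere, and its weak form follows by parts. *)

Set Implicit Arguments. Unset Strict Implicit. Unset Printing Implicit Defensive.

(** * Calculus *)

(** The regularity of the data dictates the route. The solution is only Lipschitz, so a chain rule
    applied to it directly would hold merely almost everywhere. The nonlocal rate involves no
    derivative of [w], hence is Lipschitz again, and differentiability of [w] in time is gained from
    the equation instead of assumed. The weak formulation is tested only with products [t * a z], so
    one explicit smooth bump, all of whose mixed derivatives can be controlled, is enough for this
    step. Endpoints shape the hypotheses of the lemmas. [Phi] is constrained on the half line only,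
    so its derivative at 0 is one-sided: [k] extends minus the derivative of the scaled kernel [K]
    continuously to the line and is tied to [K] at positive arguments only. In the same way [Q] is
    constrained on [[1, +oo[], which is why continuity within that set is carried separately from
    derivatives in its interior. The Lipschitz constant of a nonlocal rate carries the factor [K 0],
    which is the total mass of [k]. *)

Section calculus.
Context {R : realType}.
Notation mu := (@lebesgue_measure R).
Implicit Types (f g F h : R -> R) (a b x : R).

Lemma is_derive_continuous f x d : is_derive x 1 f d -> {for x, continuous f}.
Proof.
by move=> ?; apply/differentiable_continuous/derivable1_diffP; exact: ex_derive.
Qed.

Lemma is_derive_derive1 f x d : is_derive x 1 f d -> derive1 f x = d.
Proof. by move=> fd; rewrite derive1E; exact: derive_val. Qed.

Lemma derivable_is_derive1 f x : derivable f x 1 -> is_derive x 1 f (derive1 f x).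
Proof. by move=> fd; rewrite derive1E; exact: derivableP. Qed.

Lemma continuous_integrable_cc f a b :
  continuous f -> mu.-integrable `[a, b] (EFin \o f).
Proof.
move=> cf; apply: continuous_compact_integrable; first exact: segment_compact.
exact: continuous_subspaceT.
Qed.

Lemma Rintegral_support f a b : (forall x, f x != 0 -> a <= x <= b) ->
  Rintegral mu setT f = Rintegral mu `[a, b] f.
Proof.
move=> fs; rewrite [RHS]Rintegral_mkcond; apply: eq_Rintegral => x _.
rewrite patchE; case: ifPn => //; rewrite notin_setE/= in_itv/= => /negP xab.
by apply/eqP; apply: contraNT xab; exact: fs.
Qed.

Lemma Rintegral_FTC2 f F a b : a <= b -> {within `[a, b], continuous f} ->
  {within `[a, b], continuous F} ->
  (forall x, a < x < b -> is_derive x 1 F (f x)) ->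
  Rintegral mu `[a, b] f = F b - F a.
Proof.
rewrite le_eqVlt => /predU1P[-> _ _ _|ab cf cF dF].
  by rewrite set_itv1 Rintegral_set1 subrr.
have /continuous_within_itvP := cF => /(_ ab)[_ Fa Fb].
rewrite /Rintegral (@continuous_FTC2 _ _ F)//.
- by split => // x; rewrite in_itv/= => /dF ?; exact: ex_derive.
- by move=> x; rewrite in_itv/= => /dF; exact: is_derive_derive1.
Qed.

Lemma Rintegral_is_derive f a x : continuous f -> a < x ->
  is_derive x 1 (fun y => Rintegral mu `[a, y] f) (f x).
Proof.
move=> cf ax; have [] := @continuous_FTC1_closed _ f a x (x + 1).
- by rewrite ltrDl.
- exact: continuous_integrable_cc.
- by [].
- exact: cf.
by move=> /derivable_is_derive1 + <-.
Qed.

Lemma cvg_Rintegral_cy f a : mu.-integrable `[a, +oo[ (EFin \o f) ->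
  Rintegral mu `[a, a + n%:R] f @[n --> \oo] --> Rintegral mu `[a, +oo[ f.
Proof.
move=> intf; have := intf => /integrableP[mf _].
pose f_ n := (f \_ `[a, a + n%:R]).
have fE n : Rintegral mu `[a, a + n%:R] f = Rintegral mu `[a, +oo[ (f_ n).
  rewrite -Rintegral_mkcondr; congr Rintegral; rewrite setIidr//.
  by move=> x/=; rewrite !in_itv/= andbT => /andP[].
have [] := @dominated_convergence _ _ _ mu `[a, +oo[ _
  (fun n => EFin \o f_ n) (EFin \o f) (abse \o (EFin \o f)).
- by [].
- move=> n; apply/measurable_EFinP/measurable_restrict => //.
  by apply: measurable_funS; [| |apply/measurable_EFinP; exact: mf] => //;
    exact: subIsetl.
- exact: mf.
- apply: aeW => x /=; rewrite in_itv/= andbT => ax.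
  apply: cvg_near_cst; near=> n; rewrite /f_ patchE mem_set//= in_itv/= ax/=.
  by rewrite -lerBlDl; near: n; exact: nbhs_infty_ger.
- exact: integrable_abse.
- apply: aeW => x n _ /=; rewrite lee_fin /f_ patchE.
  by case: ifPn => // _; rewrite normr0.
move=> _ _ cvgf; rewrite (_ : (fun n => _) =
    fun n => fine (\int[mu]_(x in `[a, +oo[) (f_ n x)%:E)).
  apply: fine_cvg; rewrite fineK//; exact: integrable_fin_num.
by apply/funext => n; rewrite fE.
Unshelve. all: by end_near. Qed.

(** Integrability replaces a sign condition on [f]: by dominated convergence the integral is the
    limit of those over [[a, a + n]], to which the compact version applies. *)
Lemma Rintegral_FTC2y f F a l : mu.-integrable `[a, +oo[ (EFin \o f) ->
  {within `[a, +oo[, continuous f} -> {within `[a, +oo[, continuous F} ->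
  (forall x, a < x -> is_derive x 1 F (f x)) ->
  F x @[x --> +oo] --> l -> Rintegral mu `[a, +oo[ f = l - F a.
Proof.
move=> intf cf cF dF Fl; have := cvg_Rintegral_cy intf.
rewrite (_ : (fun n => _) = (fun n => F (a + n%:R) - F a)).
  move=> /cvg_lim <-//; apply/cvg_lim => //; apply: cvgB; last exact: cvg_cst.
  move/cvg_pinftyP : Fl; apply; apply/cvgryPge => A; near=> n.
  by rewrite -lerBlDl; near: n; exact: nbhs_infty_ger.
apply/funext => n.
have sub : `[a, a + n%:R] `<=` `[a, +oo[.
  by move=> x/=; rewrite !in_itv/= andbT => /andP[].
apply: Rintegral_FTC2; first by rewrite lerDl.
- exact: continuous_subspaceW cf.
- exact: continuous_subspaceW cF.
- by move=> x /andP[? _]; exact: dF.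
Unshelve. all: by end_near. Qed.

End calculus.

(** * Derivative of a kernel average *)

Section kernel_average.
Context {R : realType}.
Notation mu := (@lebesgue_measure R).
Implicit Types (f g h : R -> R) (a b x z : R).

Lemma derive_lipschitz f df a b C : a <= b -> {within `[a, b], continuous f} ->
  (forall x : R, a < x < b -> is_derive x 1 f (df x)) ->
  (forall x : R, a < x < b -> `|df x| <= C) -> `|f b - f a| <= C * (b - a).
Proof.
rewrite le_eqVlt => /predU1P[-> _ _ _|ab cf dfE dfC].
  by rewrite !subrr normr0 mulr0.
have dfE' x : x \in `]a, b[ -> is_derive x 1 f (df x).
  by rewrite in_itv/=; exact: dfE.
have [c cab ->] := MVT ab dfE' cf.
rewrite normrM [`|b - a|]gtr0_norm ?subr_gt0// ler_wpM2r ?subr_ge0 ?(ltW ab)//.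
by apply: dfC; move: cab; rewrite in_itv.
Qed.

Lemma is_derive_shiftl f c x d : is_derive (c + x) 1 f d ->
  is_derive x 1 (fun y => f (c + y)) d.
Proof.
move=> fd; rewrite -[d]mulr1.
apply: (@is_derive1_comp _ f (fun y => c + y)) => //.
by rewrite -[X in is_derive _ _ _ X]add0r; apply: is_deriveD.
Qed.

Lemma is_derive_shiftr f c x d : is_derive (x + c) 1 f d ->
  is_derive x 1 (fun y => f (y + c)) d.
Proof.
under eq_fun do rewrite addrC.
by rewrite addrC; exact: is_derive_shiftl.
Qed.

Lemma integrable_mul_bounded f g C : mu.-integrable `[0, +oo[ (EFin \o f) ->
  {within `[0, +oo[, continuous g} -> (forall s : R, 0 <= s -> `|g s| <= C) ->
  mu.-integrable `[0, +oo[ (EFin \o (fun s => f s * g s)).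
Proof.
move=> intf cg gC; have C0 : 0 <= C by apply: le_trans (gC 0 _).
have := intf => /integrableP[/measurable_EFinP mf _].
have intCf : mu.-integrable `[0, +oo[ (fun s => C%:E * (EFin \o f) s)%E.
  exact: integrableZl.
apply: (le_integrable _ _ _ intCf) => //.
- apply/measurable_EFinP; apply: measurable_funM => //.
  exact: subspace_continuous_measurable_fun.
- move=> s/=; rewrite in_itv/= andbT => s0; rewrite lee_fin !normrM mulrC.
  by rewrite (ger0_norm C0) ler_wpM2r// gC.
Qed.

Variables K k : R -> R.
Hypothesis k_cont : continuous k.
Hypothesis k_ge0 : forall s : R, 0 <= k s.
Hypothesis K_cont : {within `[0, +oo[, continuous K}.
Hypothesis K_derive : forall s : R, 0 < s -> is_derive s 1 K (- k s).
Hypothesis K_int : mu.-integrable `[0, +oo[ (EFin \o K).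
Hypothesis K_cvg : K x @[x --> +oo] --> 0.

(** [K] falls from [K 0] to 0 at infinity. Since [k] is nonnegative the identity holds in the
    extended reals before integrability is known, and it then yields the integrability of [k]. *)
Lemma k_integral : (\int[mu]_(s in `[0%R, +oo[) (k s)%:E = (K 0)%:E)%E.
Proof.
have /continuous_within_itvcyP[_ K0] := K_cont.
rewrite (@ge0_continuous_FTC2y _ k (- K) 0 0)//.
- by rewrite -EFinB sub0r opprK.
- exact: continuous_subspaceT.
- by rewrite -oppr0; exact: cvgN.
- by move=> x /K_derive dK; apply: derivableN; exact: ex_derive.
- exact: cvgN.
- move=> x; rewrite in_itv/= andbT => /K_derive dK.
  by rewrite (is_derive_derive1 (is_deriveN dK)) opprK.
Qed.

Lemma k_integrable : mu.-integrable `[0, +oo[ (EFin \o k).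
Proof.
apply/integrableP; split.
  by apply/measurable_EFinP; apply: measurable_funTS; exact: continuous_measurable_fun.
under eq_integral do rewrite /= ger0_norm//.
by rewrite k_integral ltry.
Qed.

(* The increment of the average is integrated by parts against the increment of
   a primitive [H] of [h], which moves the derivative onto [K]. *)
Lemma average_is_derive h B z0 : continuous h -> (forall x, `|h x| <= B) ->
  is_derive z0 1 (fun z => Rintegral mu `[0, +oo[ (fun s => K s * h (z + s)))
    (Rintegral mu `[0, +oo[ (fun s => k s * (h (z0 + s) - h z0))).
Proof.
move=> ch hB; have B0 : 0 <= B by apply: le_trans (hB 0).
(* Starting at [z0 - 1] makes [H] differentiable in the two-sided sense near [z0] and everywhere to
   its right. *)
pose H x := Rintegral mu `[z0 - 1, x] h.
have dH (x : R) : z0 - 1 < x -> is_derive x 1 H (h x) by exact: Rintegral_is_derive.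
have H_cont (x y : R) : z0 - 1 < x -> {within `[x, y], continuous H}.
  move=> zx; apply: continuous_in_subspaceT => t; rewrite inE/= in_itv/=.
  move=> /andP[xt _]; apply: is_derive_continuous; apply: dH.
  exact: lt_le_trans xt.
have H_le (x y : R) : z0 - 1 < x -> x <= y -> `|H y - H x| <= B * (y - x).
  move=> zx xy; apply: (@derive_lipschitz _ h) => //; first exact: H_cont.
  by move=> t /andP[xt _]; apply: dH; exact: lt_trans xt.
have H_lip (x y : R) : z0 - 1 < x -> z0 - 1 < y -> `|H y - H x| <= B * `|y - x|.
  move=> zx zy; have [xy|/ltW yx] := leP x y.
    by rewrite (ger0_norm (_ : 0 <= y - x)) ?subr_ge0// H_le.
  by rewrite distrC [`|y - x|]distrC (ger0_norm (_ : 0 <= x - y)) ?subr_ge0// H_le.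
(* The change, from [z0] to [z], of the integral of [h] over [[z, z + s]]. It vanishes at [s = 0];
   its [s]-derivative is the increment of [h] that appears against [K], and its [z]-derivative is
   the integrand wanted against [k]. *)
pose p z s := H (z + s) - H (z0 + s) - H z + H z0.
have dp1 (z s : R) : z0 - 1 < z -> 0 <= s -> is_derive s 1 (p z) (h (z + s) - h (z0 + s)).
  move=> zz s0.
  have d1 : is_derive (z + s) 1 H (h (z + s)).
    by apply: dH; rewrite (lt_le_trans zz)// lerDl.
  have d2 : is_derive (z0 + s) 1 H (h (z0 + s)) by apply: dH; lra.
  have e1 : is_derive s 1 (fun s => H (z + s)) (h (z + s)).
    exact: is_derive_shiftl.
  have e2 : is_derive s 1 (fun s => H (z0 + s)) (h (z0 + s)).
    exact: is_derive_shiftl.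
  have := is_deriveD (is_deriveB (is_deriveB e1 e2) (is_derive_cst (H z) s 1))
    (is_derive_cst (H z0) s 1).
  by move=> /is_derive_eq; apply; rewrite subr0 addr0.
have dp2 (z s : R) : z0 - 1 < z -> 0 <= s -> is_derive z 1 (p ^~ s) (h (z + s) - h z).
  move=> zz s0.
  have d1 : is_derive (z + s) 1 H (h (z + s)).
    by apply: dH; rewrite (lt_le_trans zz)// lerDl.
  have d2 : is_derive z 1 H (h z) by exact: dH.
  have e1 : is_derive z 1 (fun z => H (z + s)) (h (z + s)).
    exact: is_derive_shiftr.
  have := is_deriveD (is_deriveB (is_deriveB e1 (is_derive_cst (H (z0 + s)) z 1)) d2)
    (is_derive_cst (H z0) z 1).
  by move=> /is_derive_eq; apply; rewrite subr0 addr0.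
have p_cont z : z0 - 1 < z -> {within `[0, +oo[, continuous (p z)}.
  move=> zz; apply: continuous_in_subspaceT => s; rewrite inE/= in_itv/= andbT.
  by move=> s0; exact: (is_derive_continuous (dp1 _ _ zz s0)).
(* Regrouped as two increments of [H] over the distance [|z - z0| <= 1], [p] is bounded uniformly in
   [s]. *)
have p_le (z s : R) : z0 - 1 < z < z0 + 1 -> 0 <= s -> `|p z s| <= 2 * B.
  move=> /andP[z1 z2] s0; rewrite /p -addrA.
  have -> : 2 * B = B + B by lra.
  have zz1 : `|z - z0| <= 1 by rewrite ler_norml; lra.
  apply: (le_trans (ler_normD _ _)); apply: lerD.
    apply: (le_trans (H_lip _ _ _ _)); [lra|lra|].
    rewrite (_ : z + s - (z0 + s) = z - z0); last lra.
    by rewrite -[leRHS]mulr1 ler_wpM2l.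
  rewrite addrC; apply: (le_trans (H_lip _ _ _ _)); [lra|lra|].
  by rewrite distrC -[leRHS]mulr1 ler_wpM2l.
have hz_cont z : continuous (fun s => h (z + s)).
  move=> s; apply: continuous_comp; last exact: ch.
  by apply: cvgD; [exact: cvg_cst|exact: cvg_id].
have Kh_int z : mu.-integrable `[0, +oo[ (EFin \o (fun s => K s * h (z + s))).
  apply: (@integrable_mul_bounded _ _ B) => //.
  by apply: continuous_subspaceT; exact: hz_cont.
have kp_int z : z0 - 1 < z < z0 + 1 ->
    mu.-integrable `[0, +oo[ (EFin \o (fun s => k s * p z s)).
  move=> /andP[z1 z2]; apply: (@integrable_mul_bounded _ _ (2 * B)) => //.
  - exact: k_integrable.
  - exact: p_cont.
  - by move=> s; apply: p_le; rewrite z1.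
pose A z := Rintegral mu `[0, +oo[ (fun s => K s * h (z + s)).
pose P z := Rintegral mu `[0, +oo[ (fun s => k s * p z s).
have AP z : z0 - 1 < z < z0 + 1 -> A z - A z0 = P z.
  move=> zz; have /andP[z1 z2] := zz.
  rewrite /A -RintegralB//; apply/eqP; rewrite -subr_eq0; apply/eqP.
  have Kd_int : mu.-integrable `[0, +oo[
      (EFin \o (fun s => K s * h (z + s) - K s * h (z0 + s))).
    under [EFin \o _]eq_fun do rewrite /= EFinB.
    by apply: integrableB => //; exact: Kh_int.
  rewrite -RintegralB//; last exact: kp_int.
  (* [K s * p z s] is a primitive of the integrand. It tends to 0 at infinity, as [p] is bounded and
     [K] vanishes there; at 0 the factor [p z 0] is zero. *)
  transitivity (0 - K 0 * p z 0).
    apply: (@Rintegral_FTC2y _ _ (fun s => K s * p z s) 0 0).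
    - under [EFin \o _]eq_fun do rewrite /= EFinB.
      by apply: integrableB => //; exact: kp_int.
    - have ck : {within `[0, +oo[, continuous k} by exact: continuous_subspaceT.
      have c1 : {within `[0, +oo[, continuous (fun s => h (z + s))}.
        exact: continuous_subspaceT.
      have c2 : {within `[0, +oo[, continuous (fun s => h (z0 + s))}.
        exact: continuous_subspaceT.
      move=> s; apply: cvgB; first apply: cvgB.
      - by apply: cvgM; [exact: K_cont|exact: c1].
      - by apply: cvgM; [exact: K_cont|exact: c2].
      - by apply: cvgM; [exact: ck|exact: p_cont].
    - by move=> s; apply: cvgM; [exact: K_cont|exact: p_cont].
    - move=> s s0; have dKs := K_derive s0; have dps := dp1 _ _ z1 (ltW s0).
      have := is_deriveM dKs dps => /is_derive_eq; apply.
      by rewrite /GRing.scale/=; ring.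
    - apply: (@squeeze_cvgr _ _ _ _ (fun s => - (2 * B * `|K s|))
        (fun s => 2 * B * `|K s|)).
      + near=> s; rewrite -ler_norml normrM mulrC ler_wpM2r//.
        by apply: p_le => //; near: s; exact: nbhs_pinfty_ge.
      + rewrite -oppr0; apply: cvgN; rewrite -(mulr0 (2 * B)).
        apply: cvgM; first exact: cvg_cst.
        by rewrite -(normr0 R); exact: cvg_norm.
      + rewrite -(mulr0 (2 * B)); apply: cvgM; first exact: cvg_cst.
        by rewrite -(normr0 R); exact: cvg_norm.
  by rewrite (_ : p z 0 = 0) ?mulr0 ?subr0// /p !addr0; ring.
pose G (s : R) := k s * (2 * B).
have dkp (z s : R) : z0 - 1 < z < z0 + 1 -> 0 <= s ->
    is_derive z 1 (fun z => k s * p z s) (k s * (h (z + s) - h z)).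
  move=> /andP[z1 z2] s0; have := dp2 _ _ z1 s0 => d.
  exact: (@is_deriveZ _ _ _ (p ^~ s) (k s)).
have Iz0 : `]z0 - 1, z0 + 1[%classic z0 by rewrite /= in_itv/=; lra.
have Iz x : `]z0 - 1, z0 + 1[%classic x -> z0 - 1 < x < z0 + 1.
  by rewrite /= in_itv.
have i1 x : `]z0 - 1, z0 + 1[%classic x ->
    mu.-integrable `[0, +oo[ (EFin \o (fun s => k s * p x s)).
  by move=> /Iz; exact: kp_int.
have i2 (x s : R) : `]z0 - 1, z0 + 1[%classic x -> `[0, +oo[%classic s ->
    derivable (fun z => k s * p z s) x 1.
  move=> /Iz xz; rewrite /= in_itv/= andbT => s0.
  by have := dkp _ _ xz s0 => ?; exact: ex_derive.
have i3 s : 0 <= G s by rewrite mulr_ge0// mulr_ge0.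
have i4 : mu.-integrable `[0, +oo[ (EFin \o G).
  apply: (@integrable_mul_bounded _ _ (2 * B)) => //.
  - exact: k_integrable.
  - by apply: continuous_subspaceT => ?; exact: cvg_cst.
  - by move=> s _; rewrite ger0_norm// mulr_ge0.
have i5 (x s : R) : `]z0 - 1, z0 + 1[%classic x -> `[0, +oo[%classic s ->
    `|partial1of2 (fun z s => k s * p z s) x s| <= G s.
  move=> /Iz xz; rewrite /= in_itv/= andbT => s0.
  rewrite /partial1of2 (is_derive_derive1 (dkp _ _ xz s0)) normrM ger0_norm//.
  rewrite ler_wpM2l// (le_trans (ler_normB _ _))//.
  by rewrite (_ : 2 * B = B + B) ?lerD//; lra.
have dP : is_derive z0 1 P (Rintegral mu `[0, +oo[ (fun s => k s * (h (z0 + s) - h z0))).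
  have dd := @derivable_under_integral _ _ _ mu _ _ (measurable_itv _)
    z0 _ _ Iz0 i1 i2 G i3 i4 i5.
  have ee := @differentiation_under_integral _ _ _ mu _ _ (measurable_itv _)
    z0 _ _ Iz0 i1 i2 G i3 i4 i5.
  have := derivable_is_derive1 dd => /is_derive_eq; apply; rewrite ee.
  apply: eq_Rintegral => s; rewrite inE/= in_itv/= andbT => s0.
  by rewrite /partial1of2 (is_derive_derive1 (dkp _ _ (Iz _ Iz0) s0)).
apply: (near_eq_is_derive (f := fun z => P z + A z0)); last first.
  by rewrite -[X in is_derive _ _ _ X]addr0; apply: is_deriveD.
near=> z; rewrite -AP ?subrK//; apply: Iz; near: z.
by apply: near_in_itvoo; rewrite inE.
Unshelve. all: by end_near. Qed.

Lemma k_Rintegral_lipschitz f g e :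
  mu.-integrable `[0, +oo[ (EFin \o (fun s => k s * f s)) ->
  mu.-integrable `[0, +oo[ (EFin \o (fun s => k s * g s)) ->
  (forall s : R, 0 <= s -> `|f s - g s| <= e) ->
  `|Rintegral mu `[0, +oo[ (fun s => k s * f s) -
    Rintegral mu `[0, +oo[ (fun s => k s * g s)| <= K 0 * e.
Proof.
move=> intf intg fg; rewrite -RintegralB//.
have intfg : mu.-integrable `[0, +oo[ (EFin \o (fun s => k s * f s - k s * g s)).
  under [EFin \o _]eq_fun do rewrite /= EFinB.
  exact: integrableB.
apply: (le_trans (le_normr_Rintegral _ intfg)) => //.
have -> : K 0 * e = Rintegral mu `[0, +oo[ (fun s => k s * e).
  rewrite RintegralZr//; last exact: k_integrable.
  by rewrite /Rintegral k_integral.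
apply: le_Rintegral => //.
- exact: (integrable_abse intfg).
- under [EFin \o _]eq_fun do rewrite /= mulrC EFinM.
  by apply: integrableZl => //; exact: k_integrable.
- move=> s; rewrite /= in_itv/= andbT => s0.
  by rewrite -mulrBr normrM ger0_norm// ler_wpM2l// fg.
Qed.

End kernel_average.

(** * A smooth bump function *)

Section bump.
Context {R : realType}.
Implicit Types (P : {poly R}) (f g a : R -> R) (x : R).

(** A single term of the exponential series is at most its sum. *)
Lemma exprn_expRN_le n (y : R) : 0 <= y -> y ^+ n * expR (- y) <= n`!%:R.
Proof.
move=> y0; rewrite expRN ler_pdivrMr ?expR_gt0//.
case: n => [|n]; first by rewrite expr0 fact0 mul1r (le_trans _ (expR_ge1Dx y))// lerDl.
have := expR_ge1Dxn n y0; set N := (n.+1)`!%:R.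
have N0 : 0 < N :> R by rewrite ltr0n fact_gt0.
by rewrite [N * _]mulrC -ler_pdivrMr//; apply: le_trans; rewrite lerDr.
Qed.

Lemma poly_expRN_bounded P : exists C, forall y : R, 0 <= y ->
  `|P.[y]| * expR (- y) <= C.
Proof.
(* Peeling a coefficient off the polynomial leaves a factor ['X]; the extra power of [y],
   universally quantified in the induction, absorbs it. *)
suff [C PC] : exists C, forall y : R, 0 <= y -> `|P.[y]| * y ^+ 0 * expR (- y) <= C.
  by exists C => y /PC; rewrite expr0 mulr1.
elim/poly_ind: P 0%N => [|P c IH] n.
  by exists 0 => y y0; rewrite horner0 normr0 !mul0r.
have [C PC] := IH n.+1; exists (C + `|c| * n`!%:R) => y y0.
rewrite hornerMXaddC -mulrA.
have yn0 : 0 <= y ^+ n * expR (- y) by rewrite mulr_ge0 ?exprn_ge0 ?expR_ge0.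
apply: (le_trans (ler_wpM2r yn0 (ler_normD _ _))); rewrite mulrDl lerD//.
  apply: le_trans (PC _ y0); rewrite normrM (ger0_norm y0) exprS.
  by rewrite le_eqVlt; apply/orP; left; apply/eqP; ring.
by rewrite ler_wpM2l// exprn_expRN_le.
Qed.

(** The case [P = 1] is the classical function [exp(-1/x)] extended by 0. The polynomial in [1/x]
    makes the family stable under differentiation. *)
Definition flat P (x : R) := if 0 < x then P.[x^-1] * expR (- x^-1) else 0.

(** Division by [x] stays inside the family, so the difference quotients at 0 are themselves flat
    functions. *)
Lemma flat_mulX P x : flat P x = flat (P * 'X) x * x.
Proof.
rewrite /flat; case: ifPn => x0; last by rewrite mul0r.
have xx : x^-1 * x = 1 by rewrite mulVf ?gt_eqF.
by rewrite hornerMX -[LHS]mulr1 -xx; ring.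
Qed.

Lemma flat_bounded P : exists C, forall x, `|flat P x| <= C.
Proof.
have [C PC] := poly_expRN_bounded P.
exists C => x; rewrite /flat; case: ifPn => x0.
  by rewrite normrM (ger0_norm (expR_ge0 _)) PC// invr_ge0 ltW.
by rewrite normr0; apply: le_trans (PC 0 (lexx _)); rewrite mulr_ge0// expR_ge0.
Qed.

Lemma flat_is_derive P x :
  is_derive x 1 (flat P) (flat ((P - P^`()) * 'X^2) x).
Proof.
have [x0|x0|->] := ltgtP x 0.
- apply: (near_eq_is_derive (f := cst 0)).
    near=> y; rewrite /flat ltNge ltW//; near: y; exact: lt_nbhsl.
  by rewrite [flat _ _]/flat ltNge ltW//; exact: is_derive_cst.
- apply: (near_eq_is_derive (f := fun y : R => P.[y^-1] * expR (- y^-1))).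
    near=> y; rewrite /flat ifT//; near: y; exact: lt_nbhsr.
  have x_neq0 : x != 0 by rewrite gt_eqF.
  have dV : is_derive x 1 (fun y : R => y^-1) (- x ^- 2).
    by rewrite -[- _]mulr1; exact: (@is_deriveV _ id).
  have dP : is_derive x 1 (fun y : R => P.[y^-1]) (P^`().[x^-1] * - x ^- 2).
    exact: (@is_derive1_comp _ (horner P) (fun y : R => y^-1)).
  have dE : is_derive x 1 (fun y : R => expR (- y^-1)) (expR (- x^-1) * x ^- 2).
    apply: (@is_derive1_comp _ expR (fun y : R => - y^-1)).
    by rewrite -[x ^- 2]opprK; exact: is_deriveN.
  have := is_deriveM dP dE => /is_derive_eq; apply.
  rewrite /flat x0 hornerM hornerXn hornerD hornerN /GRing.scale/= -exprVn.
  by ring.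
(* At 0 the slope function is [flat (P * 'X)] by [flat_mulX]. A second use of [flat_mulX] writes it
   as a bounded function times [z], so it is continuous at 0 with value 0, as the claimed derivative
   requires. *)
- apply/is_derive1_caratheodory; exists (flat (P * 'X)); split.
  + by move=> z; rewrite subr0 [flat P 0]/flat ltxx subr0 -flat_mulX.
  + have [C PC] := flat_bounded (P * 'X * 'X).
    have f0 : flat (P * 'X) 0 = 0 by rewrite /flat ltxx.
    rewrite /prop_for /continuous_at f0; apply/cvgr0Pnorm_le => e e0.
    have C0 : 0 <= C by apply: le_trans (PC 0).
    near=> z; rewrite flat_mulX normrM.
    apply: (@le_trans _ _ (C * (e / (C + 1)))).
      apply: ler_pM => //.
      near: z; exists (e / (C + 1)) => /=; first by rewrite divr_gt0// ltr_wpDl.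
      by move=> z /=; rewrite sub0r normrN => /ltW.
    rewrite mulrCA ger_pMr// ler_pdivrMr; first by rewrite mul1r lerDl.
    by rewrite ltr_wpDl.
  + by rewrite /flat ltxx.
Unshelve. all: by end_near. Qed.

(* Closed under differentiation, so every member is smooth. *)
Inductive flat_generated : (R -> R) -> Prop :=
| flat_gen_shift P (c : R) : flat_generated (fun x => flat P (x - c))
| flat_gen_flip P (c : R) : flat_generated (fun x => flat P (c - x))
| flat_gen_mul f g : flat_generated f -> flat_generated g ->
    flat_generated (fun x => f x * g x)
| flat_gen_add f g : flat_generated f -> flat_generated g ->
    flat_generated (fun x => f x + g x)
| flat_gen_opp f : flat_generated f -> flat_generated (fun x => - f x).

Lemma flat_generated_derive f : flat_generated f ->
  exists2 f', flat_generated f' & forall x : R, is_derive x 1 f (f' x).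
Proof.
elim=> {f} [P c|P c|f g gf [f' sf df] gg [g' sg dg]|
  f g _ [f' sf df] _ [g' sg dg]|f _ [f' sf df]].
- exists (fun x => flat ((P - P^`()) * 'X^2) (x - c)).
    exact: flat_gen_shift.
  by move=> x; apply: is_derive_shiftr; exact: flat_is_derive.
- exists (fun x => - flat ((P - P^`()) * 'X^2) (c - x)).
    by apply: flat_gen_opp; exact: flat_gen_flip.
  move=> x; rewrite -mulrN1.
  apply: (@is_derive1_comp _ (flat P) (fun x => c - x)).
    exact: flat_is_derive.
  rewrite -[X in is_derive _ _ _ X]sub0r.
  by have := is_deriveB (is_derive_cst c x 1) (is_derive_id x (1 : R)).
- exists (fun x => f' x * g x + f x * g' x).
    apply: flat_gen_add; first exact: flat_gen_mul sf gg.
    exact: flat_gen_mul gf sg.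
  move=> x; have := is_deriveM (df x) (dg x) => /is_derive_eq; apply.
  by rewrite /GRing.scale/=; ring.
- exists (fun x => f' x + g' x); first exact: flat_gen_add.
  by move=> x; exact: is_deriveD.
- exists (fun x => - f' x); first exact: flat_gen_opp.
  by move=> x; exact: is_deriveN.
Qed.

(** Left unnormalised: its integral only has to be positive and is divided out at the end of the
    localisation. *)
Definition bump (c d x : R) : R := flat 1 (x - (c - d)) * flat 1 (c + d - x).

Lemma bump_generated c d : flat_generated (bump c d).
Proof. by apply: flat_gen_mul; [exact: flat_gen_shift|exact: flat_gen_flip]. Qed.

Lemma flat1_gt0 (x : R) : (0 < flat 1 x) = (0 < x).
Proof.
rewrite /flat; case: ifPn => [_|_]; last by rewrite ltxx.
by rewrite hornerC mul1r expR_gt0.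
Qed.

Lemma flat1_ge0 (x : R) : 0 <= flat 1 x.
Proof. by rewrite /flat; case: ifPn => // _; rewrite hornerC mul1r expR_ge0. Qed.

Lemma bump_ge0 c d x : 0 <= bump c d x.
Proof. by rewrite mulr_ge0 ?flat1_ge0. Qed.

Lemma bump_gt0 (c d x : R) : c - d < x < c + d -> 0 < bump c d x.
Proof. by move=> /andP[cx xc]; rewrite mulr_gt0// flat1_gt0; lra. Qed.

Lemma bump_support c d x : bump c d x != 0 -> c - d < x < c + d.
Proof.
have flat_neq0 y : flat 1 y != 0 -> 0 < y.
  by rewrite /flat; case: ifPn => //; rewrite eqxx.
by rewrite /bump mulf_eq0 negb_or => /andP[/flat_neq0 + /flat_neq0]; lra.
Qed.

Lemma affine_is_derive (A B t : R) : is_derive t 1 (fun t => A + B * t) B.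
Proof.
have := is_deriveD (is_derive_cst A t 1) (is_deriveZ B (is_derive_id t (1 : R))).
by move=> /is_derive_eq; apply; rewrite add0r /GRing.scale/= mulr1.
Qed.

(** The shape is preserved by both derivatives: [dz] acts on the generated factor, [dt] turns the
    affine factor into a constant, again affine. Every mixed derivative is thereby known explicitly
    enough to be continuous and differentiable. *)
Lemma dmix_generated a (A B : R) (l : seq bool) : flat_generated a ->
  exists a' (A' B' : R), flat_generated a' /\
    dmix l (fun z t => a z * (A + B * t)) = (fun z t => a' z * (A' + B' * t)).
Proof.
move=> sa; elim: l => [|b l [a' [A' [B' [sa' dE]]]]] /=; first by exists a, A, B.
have [a'' sa'' da'] := flat_generated_derive sa'.
rewrite dE; case: b.
- exists a'', A', B'; split => //; apply/funext => z; apply/funext => t.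
  rewrite /dz; apply: is_derive_derive1.
  have := is_deriveM (da' z) (is_derive_cst (A' + B' * t) z 1).
  by move=> /is_derive_eq; apply; rewrite /GRing.scale/=; ring.
- exists a', B', 0; split => //; apply/funext => z; apply/funext => t.
  rewrite /dt; apply: is_derive_derive1.
  have := is_deriveZ (a' z) (affine_is_derive A' B' t) => /is_derive_eq; apply.
  by rewrite /GRing.scale/=; ring.
Qed.

Lemma tensor_smooth2 a (A B : R) : flat_generated a ->
  smooth2 (fun z t => a z * (A + B * t)).
Proof.
move=> sa l; have [a' [A' [B' [sa' ->]]]] := dmix_generated A B l sa.
have [a'' _ da'] := flat_generated_derive sa'.
split=> [|z t].
- move=> [z t]; apply: cvgM => /=.
    apply: (@cvg_comp _ _ _ fst a'); first exact: cvg_fst.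
    exact: (is_derive_continuous (da' z)).
  apply: (@cvg_comp _ _ _ snd (fun t => A' + B' * t)); first exact: cvg_snd.
  exact: (is_derive_continuous (affine_is_derive A' B' t)).
- split.
    have := is_deriveM (da' z) (is_derive_cst (A' + B' * t) z 1) => ?.
    exact: ex_derive.
  have := is_deriveZ (a' z) (affine_is_derive A' B' t) => ?.
  exact: ex_derive.
Qed.

End bump.

(** * The kernel *)

Section kernel_of_Phi.
Context {R : realType}.
Notation mu := (@lebesgue_measure R).
Implicit Types (f : R -> R) (a x d : R).

Lemma nincr_derive_le0 f a x d : a < x ->
  (forall y z, a <= y -> y <= z -> f z <= f y) -> is_derive x 1 f d -> d <= 0.
Proof.
move=> ax fle fd; have <- := @derive_val _ _ _ _ _ _ _ fd.
have fx : derivable f x 1 by exact: ex_derive.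
apply: limr_le; first exact: fx.
near=> h; rewrite /= scaler1 /GRing.scale/=.
have h0 : h != 0 by near: h; exact: nbhs_dnbhs_neq.
have ahx : a <= h + x.
  rewrite -lerBlDr -(opprK h) lerNr opprB.
  rewrite (le_trans (ler_norm _))// normrN.
  by near: h; apply: dnbhs0_le; rewrite subr_gt0.
move: h0; rewrite neq_lt => /orP[h0|h0].
- by rewrite nmulr_rle0 ?invr_lt0// subr_ge0 fle// gerDr ltW.
- by rewrite pmulr_rle0 ?invr_gt0// subr_le0 fle ?lerDr// ltW.
Unshelve. all: by end_near. Qed.

(** Composition with the absolute value extends a function from the half line to the whole line
    without changing it there, turning one-sided continuity at 0 into continuity. *)
Lemma continuous_comp_norm f :
  {within `[0, +oo[, continuous f} -> continuous (fun x : R => f `|x|).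
Proof.
move=> /subspace_continuousP cf x.
have x0 : `[0, +oo[%classic `|x| by rewrite /= in_itv/= normr_ge0.
apply: cvg_comp (cf _ x0) => P /= Pwithin.
rewrite nbhs_simpl/=; have /= := @norm_continuous _ _ x _ Pwithin.
rewrite nbhs_simpl/=; apply: filterS => y; apply.
by rewrite in_itv/= normr_ge0.
Qed.

Variables (Phi : R -> R) (alpha : R).
Hypothesis Phi_ge0 : forall z, 0 <= z -> 0 <= Phi z.
Hypothesis Phi_nincr : forall x y, 0 <= x -> x <= y -> Phi y <= Phi x.
Hypothesis Phi_int : (\int[mu]_(z in `[0%R, +oo[) (Phi z)%:E = 1)%E.
Hypothesis Phi_C1 : C1_nonneg Phi.
Hypothesis alpha0 : 0 < alpha.

Let K := Phi_a Phi alpha.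

Let Phi_abs_cont : continuous (fun x : R => Phi `|x|).
Proof. by apply: continuous_comp_norm; case: Phi_C1. Qed.

Let scale_cont : continuous (fun x : R => x / alpha).
Proof. by move=> x; apply: cvgM; [exact: cvg_id|exact: cvg_cst]. Qed.

Let scale_is_derive x : is_derive x 1 (fun x : R => x / alpha) alpha^-1.
Proof.
have := is_deriveM (is_derive_id x (1 : R)) (is_derive_cst alpha^-1 x (1 : R)).
by move=> /is_derive_eq; apply; rewrite scaler0 add0r /GRing.scale/= mulr1.
Qed.

Let K_cont : {within `[0, +oo[, continuous K}.
Proof.
have c : continuous (fun x => alpha^-1 * Phi `|x / alpha|).
  move=> x; apply: cvgM; first exact: cvg_cst.
  apply: (@continuous_comp _ _ _ (fun x => x / alpha) (fun x => Phi `|x|)).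
    exact: scale_cont.
  exact: Phi_abs_cont.
have cA : {within `[0, +oo[, continuous (fun x => alpha^-1 * Phi `|x / alpha|)}.
  exact: continuous_subspaceT.
apply: subspace_eq_continuous cA => x; rewrite inE/= in_itv/= andbT => x0.
by rewrite /from_subspace /K /Phi_a ger0_norm// divr_ge0// ltW.
Qed.

(** On [[0, x]] a non-increasing [Phi] is at least [Phi x], and its integral there is at most 1.
    This is the decay that sends the kernel to 0 at infinity. *)
Let Phi_mul_le1 x : 0 < x -> x * Phi x <= 1.
Proof.
move=> x0; rewrite -lee_fin -Phi_int.
have mPhi : measurable_fun (`[0, +oo[%classic : set R) (EFin \o Phi).
  apply/measurable_EFinP; apply: subspace_continuous_measurable_fun => //.
  by case: Phi_C1.
have sub : `[0, x] `<=` `[0%R, +oo[.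
  by move=> y /=; rewrite !in_itv/= andbT => /andP[].
apply: (@le_trans _ _ (\int[mu]_(z in `[0%R, x]) (Phi z)%:E)%E); last first.
  apply: ge0_subset_integral => // y; rewrite /= in_itv/= andbT => y0.
  by rewrite lee_fin Phi_ge0.
apply: (@le_trans _ _ (\int[mu]_(z in `[0%R, x]) (cst (Phi x)%:E z))%E).
  rewrite integral_cst//= lebesgue_measure_itv/= lte_fin x0 oppr0 adde0 mulrC.
  by rewrite EFinM.
apply: ge0_le_integral => //.
- by move=> y _; rewrite lee_fin Phi_ge0// ltW.
- exact: measurable_funS mPhi.
- by move=> y; rewrite /= in_itv/= => /andP[y0 yx]; rewrite lee_fin Phi_nincr.
Qed.

Let K_cvg : K x @[x --> +oo] --> 0.
Proof.
apply: (@squeeze_cvgr _ _ _ _ (cst 0) (fun x => x^-1)).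
- near=> x; have x0 : 0 < x by near: x; exact: nbhs_pinfty_gt.
  have xa0 : 0 < x / alpha by rewrite divr_gt0.
  rewrite /= /K /Phi_a mulr_ge0 ?invr_ge0 ?(ltW alpha0) ?Phi_ge0 ?(ltW xa0)//=.
  have := Phi_mul_le1 xa0; rewrite -ler_pdivlMl// mulr1 => Ple.
  rewrite -(ler_pM2l alpha0) mulrA divff ?gt_eqF// mul1r.
  by apply: le_trans Ple _; rewrite invf_div.
- exact: cvg_cst.
- apply/cvgr0Pnorm_le => e e0; near=> x.
  have x0 : 0 < x by near: x; exact: nbhs_pinfty_gt.
  rewrite gtr0_norm ?invr_gt0// -(invrK e) lef_pV2 ?posrE ?invr_gt0//.
Unshelve. all: by end_near. Qed.

Let K_int : mu.-integrable `[0, +oo[ (EFin \o K).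
Proof.
apply/integrableP; split.
  by apply/measurable_EFinP; exact: subspace_continuous_measurable_fun.
have F'E : derive1 (fun x : R => x / alpha) = cst alpha^-1.
  by apply/funext => x; exact: is_derive_derive1 (scale_is_derive x).
have : (\int[mu]_(x in `[(0 / alpha)%R, +oo[) (Phi x)%:E < +oo)%E.
  by rewrite mul0r Phi_int ltry.
rewrite (@increasing_ge0_integration_by_substitutiony _ (fun x => x / alpha)).
- apply: le_lt_trans; rewrite le_eqVlt; apply/orP; left; apply/eqP.
  apply: eq_integral => x; rewrite inE/= in_itv/= andbT => x0.
  rewrite F'E /= /K /Phi_a ger0_norm mulrC//.
  by rewrite mulr_ge0 ?invr_ge0 ?Phi_ge0 ?(ltW alpha0)// divr_ge0// ltW.
- by move=> x y _ _ xy; rewrite ltr_pM2r// invr_gt0.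
- by rewrite F'E => x _; exact: cvg_cst.
- by rewrite F'E; exact: is_cvg_cst.
- by rewrite F'E; exact: is_cvg_cst.
- split; last by apply: cvg_at_right_filter; exact: scale_cont.
  by move=> x _; have := scale_is_derive x => ?; exact: ex_derive.
- apply/cvgryPge => A; near=> x; rewrite ler_pdivlMr//.
- by rewrite mul0r; case: Phi_C1.
- by move=> x; rewrite mul0r in_itv/= andbT => /ltW; exact: Phi_ge0.
Unshelve. all: by end_near. Qed.

Lemma Phi_a_kernel : exists k : R -> R,
  [/\ continuous k, (forall s : R, 0 <= k s),
      (forall s : R, 0 < s -> is_derive s 1 K (- k s)) &
   [/\ {within `[0, +oo[, continuous K}, mu.-integrable `[0, +oo[ (EFin \o K) &
      K x @[x --> +oo] --> 0]].
Proof.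
have [_ [f' [f'_cont [f'_derive f'_0]]]] := Phi_C1.
(* At positive points the sign comes from the two-sided derivative; at 0 only the right difference
   quotient [f'_0] is available. *)
have f'_le0 x : 0 <= x -> f' x <= 0.
  rewrite le_eqVlt => /predU1P[<-|x0]; last first.
    exact: nincr_derive_le0 x0 Phi_nincr (f'_derive _ x0).
  apply: (cvgr_to_le f'_0); near=> h.
  have h0 : 0 < h by near: h; exact: nbhs_right_gt.
  by rewrite pmulr_rle0 ?invr_gt0// subr_le0 Phi_nincr// ltW.
(* One [alpha^-1] is the prefactor of [Phi_a], the other comes from the chain rule; the absolute
   value extends [f'] continuously to negative arguments. *)
exists (fun s => alpha^-1 * (alpha^-1 * - f' `|s / alpha|)); split; [| | |by split].
- move=> x; apply: cvgM; first exact: cvg_cst.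
  apply: cvgM; [exact: cvg_cst|apply: cvgN].
  apply: (@continuous_comp _ _ _ (fun x => x / alpha) (fun x => f' `|x|)).
    exact: scale_cont.
  exact: continuous_comp_norm.
- by move=> s; rewrite !mulr_ge0 ?invr_ge0 ?(ltW alpha0)// oppr_ge0 f'_le0.
- move=> s s0; have sa0 : 0 < s / alpha by rewrite divr_gt0.
  have := is_deriveZ alpha^-1
    (@is_derive1_comp _ Phi (fun x => x / alpha) _ _ _ (f'_derive _ sa0) (scale_is_derive s)).
  move=> /is_derive_eq; apply; rewrite ger0_norm ?ltW// /GRing.scale/=; ring.
Unshelve. all: by end_near. Qed.

End kernel_of_Phi.

(** * The entropy flux *)

Section entropy_flux.
Context {R : realType}.
Notation mu := (@lebesgue_measure R).
Implicit Types (f F q : R -> R) (a b c x y M : R).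

Lemma continuous_within_cy f c :
  (forall x, c <= x -> {for x, continuous f}) -> {within `[c, +oo[, continuous f}.
Proof.
move=> cf; apply: continuous_in_subspaceT => x; rewrite inE/= in_itv/= andbT.
exact: cf.
Qed.

Lemma within_cyS f c a b : c <= a ->
  {within `[c, +oo[, continuous f} -> {within `[a, b], continuous f}.
Proof.
move=> ca; apply: continuous_subspaceW => x; rewrite /= !in_itv/= andbT.
by move=> /andP[ax _]; exact: le_trans ax.
Qed.

Lemma oint_FTC2 f F c a b : c <= a -> c <= b ->
  {within `[c, +oo[, continuous f} -> {within `[c, +oo[, continuous F} ->
  (forall x, c < x -> is_derive x 1 F (f x)) -> oint a b f = F b - F a.
Proof.
move=> ca cb cf cF dF; rewrite /oint; case: ifPn => [ab|]; last first.
  rewrite -ltNge => /ltW ba; rewrite -[RHS]opprB; congr (- _).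
  apply: Rintegral_FTC2 => //; [exact: within_cyS cf|exact: within_cyS cF|].
  by move=> x /andP[bx _]; apply: dF; exact: le_lt_trans bx.
apply: Rintegral_FTC2 => //; [exact: within_cyS cf|exact: within_cyS cF|].
by move=> x /andP[bx _]; apply: dF; exact: le_lt_trans bx.
Qed.

(** The absolute value of [q'] has a maximum on the compact [[1, M]], and the mean value theorem
    asks of [q] only continuity within the interval, which is all that is known of [Q] at 1. *)
Lemma lipschitz_bounded_derive q q' M : {within `[1, +oo[, continuous q} ->
  (forall x, 1 <= x -> {for x, continuous q'}) ->
  (forall x, 1 < x -> is_derive x 1 q (q' x)) ->
  exists C, forall a b, 1 <= a <= M -> 1 <= b <= M ->
    `|q b - q a| <= C * `|b - a|.
Proof.
move=> cq cq' dq; have [M1|M1] := ltP M 1.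
  (* For [M < 1] no [a] satisfies the bounds, so any constant works. *)
  by exists 0 => a b /andP[]; lra.
have [] := @EVT_max R (Num.norm \o q') 1 M M1.
  apply: (@within_cyS _ 1) => //; apply: continuous_within_cy => x x1.
  by apply: continuous_comp; [exact: cq'|exact: norm_continuous].
move=> m _ qm; exists `|q' m|.
have main a b : 1 <= a -> a <= b -> b <= M -> `|q b - q a| <= `|q' m| * (b - a).
  move=> a1 ab bM; apply: (@derive_lipschitz _ _ q') => //.
  - exact: within_cyS cq.
  - by move=> x /andP[ax _]; apply: dq; exact: le_lt_trans ax.
  - by move=> x /andP[ax xb]; apply: (qm x); rewrite in_itv/=; lra.
move=> a b /andP[a1 aM] /andP[b1 bM]; have [ab|/ltW ba] := leP a b.
  by rewrite (ger0_norm (_ : 0 <= b - a)) ?subr_ge0// main.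
by rewrite distrC [`|b - a|]distrC (ger0_norm (_ : 0 <= a - b)) ?subr_ge0// main.
Qed.

(** By convexity the right difference quotients at 0 of [l |-> f (x + l * (y - x))] are at most
    [f y - f x] for [l <= 1]; their limit is the left-hand side. *)
Lemma convex_tangent f x y d : convex_fun f -> is_derive x 1 f d ->
  d * (y - x) <= f y - f x.
Proof.
move=> cf fd; pose g l := f (x + l * (y - x)).
have dg : is_derive (0 : R) 1 g (d * (y - x)).
  apply: (@is_derive1_comp _ f (fun l => x + l * (y - x))).
    by rewrite mul0r addr0.
  have := is_deriveD (is_derive_cst x (0 : R) (1 : R))
    (is_deriveM (is_derive_id (0 : R) (1 : R)) (is_derive_cst (y - x) (0 : R) (1 : R))).
  by move=> /is_derive_eq; apply; rewrite scaler0 !add0r /GRing.scale/= mulr1.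
have /is_derive1_caratheodory[G [gG G0 <-]] := dg.
have G0r : G z @[z --> 0^'+] --> G 0 by apply: cvg_at_right_filter; exact: G0.
apply: (cvgr_to_le G0r); near=> z.
have z0 : 0 < z by near: z; exact: nbhs_right_gt.
have z1 : z <= 1 by near: z; exact: nbhs_right_le.
rewrite -(ler_pM2r z0); have := gG z; rewrite subr0 => <-.
have := cf y x z (ltW z0) z1; rewrite /g mul0r addr0.
rewrite (_ : z * y + (1 - z) * x = x + z * (y - x)); last ring.
by lra.
Unshelve. all: by end_near. Qed.

(** Adding the tangent inequalities at [x] and at [y] gives [(f' y - f' x) * (y - x) >= 0]. *)
Lemma convex_derive_ndecr f f' x y : convex_fun f ->
  (forall x, is_derive x 1 f (f' x)) -> x <= y -> f' x <= f' y.
Proof.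
move=> cf df; rewrite le_eqVlt => /predU1P[->//|xy].
have := convex_tangent y cf (df x); have := convex_tangent x cf (df y).
move=> Tyx Txy; rewrite -(ler_pM2r (_ : 0 < y - x)) ?subr_gt0//; lra.
Qed.

End entropy_flux.

(** * The double integral in the dissipation: closed form and sign *)

Section dissipation.
Context {R : realType}.
Notation mu := (@lebesgue_measure R).
Implicit Types (a b x y : R).
Variables (V eta Q : R -> R).
Hypothesis V_C1 : C1_nonneg V.
Hypothesis V_nincr : forall x y, 0 <= x -> x <= y -> V y <= V x.

Let W := Wof V.
Let W' := derive1 W.

(** [W' x = - V'(1/x) / x^2]. For [x > 0] the point [1/x] is interior to the domain of [V], so its
    one-sided derivative at 0 never enters. *)
Lemma Wof_facts x : 0 < x ->
  [/\ is_derive x 1 W (W' x), {for x, continuous W'} & 0 <= W' x].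
Proof.
have [_ [V' [V'_cont [V'_derive _]]]] := V_C1.
have dW (y : R) : 0 < y -> is_derive y 1 W (V' y^-1 * - y ^- 2).
  move=> y0; have y1 : 0 < y^-1 by rewrite invr_gt0.
  have dV : is_derive y 1 (fun y : R => y^-1) (- y ^- 2).
    by rewrite -[- _]mulr1; apply: (@is_deriveV _ id); rewrite gt_eqF.
  rewrite /W /Wof; under eq_fun do rewrite div1r.
  exact: (@is_derive1_comp _ V (fun y : R => y^-1) _ _ _ (V'_derive _ y1) dV).
have W'E (y : R) : 0 < y -> W' y = V' y^-1 * - y ^- 2.
  by move=> y0; exact: is_derive_derive1 (dW _ y0).
move=> x0; split.
- by rewrite W'E//; exact: dW.
- rewrite /prop_for /continuous_at W'E//.
  have inv_cont : y^-1 @[y --> x] --> x^-1 by apply: inv_continuous; rewrite gt_eqF.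
  have rhs_cvg : V' y^-1 * - y ^- 2 @[y --> x] --> V' x^-1 * - x ^- 2.
    apply: cvgM.
      apply: (cvg_comp _ _ inv_cont).
      have /continuous_within_itvcyP[+ _] := V'_cont; apply.
      by rewrite in_itv/= andbT invr_gt0.
    apply: cvgN; rewrite -exprVn; under eq_fun do rewrite -exprVn.
    exact: cvgM.
  apply: cvg_trans rhs_cvg.
  by apply: near_eq_cvg; near=> y; rewrite W'E//; near: y; exact: lt_nbhsr.
- rewrite W'E// mulrN -mulNr mulr_ge0// ?invr_ge0 ?exprn_ge0 ?(ltW x0)//.
  rewrite oppr_ge0; have y1 : 0 < x^-1 by rewrite invr_gt0.
  exact: nincr_derive_le0 y1 V_nincr (V'_derive _ y1).
Unshelve. all: by end_near. Qed.

Hypothesis eta_C2 : C2 eta.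
Hypothesis eta_convex : convex_fun eta.
Hypothesis Q_cont : {within `[1, +oo[, continuous Q}.
Hypothesis Q_derive :
  forall x : R, 1 < x -> is_derive x (1 : R) Q (derive1 eta x * W' x).

Lemma C2_facts x : [/\ is_derive x 1 eta (derive1 eta x),
  is_derive x 1 (derive1 eta) (derive1 (derive1 eta) x) &
  {for x, continuous (derive1 eta)}].
Proof.
have [d1 [d2 _]] := eta_C2; have e2 := derivable_is_derive1 (d2 x).
split => //; first exact: derivable_is_derive1.
exact: is_derive_continuous e2.
Qed.

Lemma Wof_cont : {within `[1, +oo[, continuous W}.
Proof.
apply: continuous_within_cy => x x1.
by have [/is_derive_continuous] := Wof_facts (lt_le_trans ltr01 x1).
Qed.

(** Freezing [eta'] at [a] produces a primitive of [(eta' - eta' a) * W'], which is what the inner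
    integral of [eta''] leaves. *)
Lemma entropy_increment_is_derive a x : 1 < x ->
  is_derive x 1 (fun s => Q s - derive1 eta a * W s)
    ((derive1 eta x - derive1 eta a) * W' x).
Proof.
move=> x1; have [dW _ _] := Wof_facts (lt_trans ltr01 x1).
have := is_deriveB (Q_derive x1) (is_deriveZ (derive1 eta a) dW).
by move=> /is_derive_eq; apply; rewrite /GRing.scale/= mulrBl.
Qed.

Lemma entropy_increment_cont a :
  {within `[1, +oo[, continuous (fun s => Q s - derive1 eta a * W s)}.
Proof.
move=> x; apply: cvgB; first exact: Q_cont.
by apply: cvgM; [exact: cvg_cst|exact: Wof_cont].
Qed.

Lemma oint_dissipation a b : 1 <= a -> 1 <= b ->
  oint a b (fun s => oint a s (fun m => derive1 (derive1 eta) m * W' s)) =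
  Q b - Q a - derive1 eta a * (W b - W a).
Proof.
move=> a1 b1; have [_ [_ eta2_cont]] := eta_C2.
have -> : (fun s => oint a s (fun m => derive1 (derive1 eta) m * W' s)) =
    (fun s => (derive1 eta s - derive1 eta a) * W' s).
  apply/funext => s.
  rewrite mulrBl.
  (* The integrands are identified as functions, hence at every real [s], also below 1; so the base
     point is [Num.min a s]. In the inner variable [W' s] is a constant. *)
  apply: (@oint_FTC2 _ _ (fun m => derive1 eta m * W' s) (Num.min a s)).
  - by rewrite ge_min lexx.
  - by rewrite ge_min lexx orbT.
  - apply: continuous_within_cy => x _.
    by apply: cvgM; [exact: eta2_cont|exact: cvg_cst].
  - apply: continuous_within_cy => x _.
    by apply: cvgM; [have [] := C2_facts x|exact: cvg_cst].
  - move=> x _; have [_ d2 _] := C2_facts x.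
    have := is_deriveM d2 (is_derive_cst (W' s) x (1 : R)).
    by move=> /is_derive_eq; apply; rewrite scaler0 add0r /GRing.scale/= mulrC.
transitivity (Q b - derive1 eta a * W b - (Q a - derive1 eta a * W a)); last by ring.
apply: (@oint_FTC2 _ _ (fun s => Q s - derive1 eta a * W s) 1) => //.
- apply: continuous_within_cy => x x1.
  have [_ W'c _] := Wof_facts (lt_le_trans ltr01 x1).
  apply: cvgM; last exact: W'c.
  by apply: cvgB; [have [] := C2_facts x|exact: cvg_cst].
- exact: entropy_increment_cont.
- by move=> x x1; exact: entropy_increment_is_derive.
Qed.

(** The derivative of [F] at [s] has the sign of [s - a], because [eta'] is non-decreasing and
    [W' >= 0]; hence [F] has its minimum over [[1, +oo[] at [a]. *)
Lemma dissipation_ge0 a b : 1 <= a -> 1 <= b ->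
  0 <= Q b - Q a - derive1 eta a * (W b - W a).
Proof.
move=> a1 b1; pose F s := Q s - derive1 eta a * W s.
suff : F a <= F b by rewrite /F; lra.
have eta1 (x y : R) : x <= y -> derive1 eta x <= derive1 eta y.
  have deta (z : R) : is_derive z 1 eta (derive1 eta z) by have [] := C2_facts z.
  exact: (convex_derive_ndecr eta_convex deta).
have [ab|/ltW ba] := leP a b.
- have dF (x : R) : x \in `]a, b[ ->
      is_derive x 1 F ((derive1 eta x - derive1 eta a) * W' x).
    rewrite in_itv/= => /andP[ax _]; apply: entropy_increment_is_derive.
    exact: le_lt_trans ax.
  have cF : {within `[a, b], continuous F}.
    by apply: (@within_cyS _ _ 1) => //; exact: entropy_increment_cont.
  have [c] := MVT_segment ab dF cF; rewrite in_itv/= => /andP[ac _].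
  have [_ _ W'c] := Wof_facts (lt_le_trans ltr01 (le_trans a1 ac)).
  move=> Fba; rewrite -subr_ge0 Fba mulr_ge0 ?subr_ge0// mulr_ge0// subr_ge0.
  exact: eta1.
- have dF (x : R) : x \in `]b, a[ ->
      is_derive x 1 F ((derive1 eta x - derive1 eta a) * W' x).
    rewrite in_itv/= => /andP[bx _]; apply: entropy_increment_is_derive.
    exact: le_lt_trans bx.
  have cF : {within `[b, a], continuous F}.
    by apply: (@within_cyS _ _ 1) => //; exact: entropy_increment_cont.
  have [c] := MVT_segment ba dF cF; rewrite in_itv/= => /andP[bc ca].
  have [_ _ W'c] := Wof_facts (lt_le_trans ltr01 (le_trans b1 bc)).
  move=> Fab; rewrite -subr_le0 Fab mulr_le0_ge0 ?subr_ge0//.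
  by rewrite mulr_le0_ge0// subr_le0; exact: eta1.
Qed.

End dissipation.

(** * Lipschitz functions of two variables *)

Section lipschitz2.
Context {R : realType}.
Notation mu := (@lebesgue_measure R).

Definition lipschitz2 (L : R) (g : R -> R -> R) :=
  forall z t z' t', `|g z t - g z' t'| <= L * (`|z - z'| + `|t - t'|).

Implicit Types (L d e p r z t : R) (a f : R -> R) (g : R -> R -> R).

Lemma lipschitz2_ge0 L g : lipschitz2 L g -> 0 <= L.
Proof.
move=> /(_ 1 0 0 0); rewrite !subr0 normr0 normr1 addr0 mulr1.
exact: le_trans.
Qed.

Lemma lipschitz2_continuous L g :
  lipschitz2 L g -> continuous (fun x : R * R => g x.1 x.2).
Proof.
move=> gL; have L0 := lipschitz2_ge0 gL.
move=> [z t]; apply/cvgrPdist_le => /= e e0.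
(* The 2 shares [e] between the coordinates; [L + 1] keeps the denominator positive when [L = 0]. *)
have d0 : 0 < e / (2 * (L + 1)) by rewrite divr_gt0// mulr_gt0// ltr_wpDl.
have c1 : x.1 @[x --> (z, t)] --> z by exact: cvg_fst.
have c2 : x.2 @[x --> (z, t)] --> t by exact: cvg_snd.
move/cvgrPdist_le : c1 => /(_ _ d0) n1; move/cvgrPdist_le : c2 => /(_ _ d0) n2.
near=> x; apply: (le_trans (gL _ _ _ _)).
have x1 : `|z - x.1| <= e / (2 * (L + 1)).
  by near: x.
have x2 : `|t - x.2| <= e / (2 * (L + 1)).
  by near: x.
apply: (@le_trans _ _ (L * (e / (L + 1)))).
  rewrite ler_wpM2l// (le_trans (lerD x1 x2))//.
  by rewrite invfM le_eqVlt; apply/orP; left; apply/eqP; field; lra.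
by rewrite mulrCA ger_pMr// ler_pdivrMr ?mul1r ?lerDl// ltr_wpDl.
Unshelve. all: by end_near. Qed.

Lemma continuous2_l g : continuous (fun x : R * R => g x.1 x.2) ->
  forall t, continuous (g ^~ t).
Proof.
move=> cg t z; apply: (@continuous2_cvg _ _ _ _ _ _ _ _ g).
- exact: (cg (z, t)).
- exact: cvg_id.
- exact: cvg_cst.
Qed.

Lemma continuous2_r g : continuous (fun x : R * R => g x.1 x.2) ->
  forall z, continuous (g z).
Proof.
move=> cg z t; apply: (@continuous2_cvg _ _ _ _ _ _ _ _ g).
- exact: (cg (z, t)).
- exact: cvg_cst.
- exact: cvg_id.
Qed.

(** Compares a weighted integral with a point value: for Lipschitz [f] and a bump of half-width [d]
    at a point, [e] is proportional to [d]. *)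
Lemma weighted_Rintegral_close f a (c e p r : R) : continuous f -> continuous a ->
  (forall x, 0 <= a x) -> (forall x, p <= x <= r -> `|f x - c| <= e) ->
  `|Rintegral mu `[p, r] (fun x => f x * a x) - c * Rintegral mu `[p, r] a| <=
  e * Rintegral mu `[p, r] a.
Proof.
move=> cf ca a0 fc.
have ia : mu.-integrable `[p, r] (EFin \o a) by exact: continuous_integrable_cc.
have cfa : continuous (fun x => f x * a x).
  by move=> x; apply: cvgM; [exact: cf|exact: ca].
have cca c' : continuous (fun x => c' * a x).
  by move=> x; apply: cvgM; [exact: cvg_cst|exact: ca].
rewrite -!RintegralZl// -RintegralB//; [|exact: continuous_integrable_cc..].
have cd : continuous (fun x => f x * a x - c * a x).
  by move=> x; apply: cvgB; [exact: cfa|exact: cca].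
apply: (le_trans (le_normr_Rintegral _ _)) => //.
  exact: continuous_integrable_cc.
apply: le_Rintegral => //; [|exact: continuous_integrable_cc|].
  apply: continuous_integrable_cc => x.
  by apply: cvg_norm; exact: cd.
move=> x /=; rewrite in_itv/= => xpr.
by rewrite -mulrBl normrM (ger0_norm (a0 x)) ler_wpM2r// fc.
Qed.

Lemma weighted_Rintegral_continuous L g a p r : lipschitz2 L g -> continuous a ->
  (forall x, 0 <= a x) ->
  continuous (fun t => Rintegral mu `[p, r] (fun z => g z t * a z)).
Proof.
move=> gL ca a0; have gc := lipschitz2_continuous gL.
have gac t : continuous (fun z => g z t * a z).
  by move=> z; apply: cvgM; [exact: continuous2_l gc t z|exact: ca].
have I0 : 0 <= Rintegral mu `[p, r] a by apply: Rintegral_ge0.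
set I := Rintegral mu `[p, r] a in I0.
have L0 := lipschitz2_ge0 gL.
(* A dummy first variable lets the two-variable Lipschitz lemma deliver continuity in [t]. *)
pose h z t := Rintegral mu `[p, r] (fun z => g z t * a z).
suff hL : lipschitz2 (L * I) h by exact: continuous2_r (lipschitz2_continuous hL) 0.
move=> z t z' t'; rewrite /h -RintegralB//; [|exact: continuous_integrable_cc..].
have cd : continuous (fun z => g z t * a z - g z t' * a z).
  by move=> x; apply: cvgB; exact: gac.
apply: (le_trans (le_normr_Rintegral _ _)) => //.
  exact: continuous_integrable_cc.
apply: (@le_trans _ _ (L * `|t - t'| * I)); last first.
  by rewrite mulrAC ler_wpM2l ?mulr_ge0// lerDr.
rewrite -RintegralZl//; last exact: continuous_integrable_cc.
apply: le_Rintegral => //.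
- apply: continuous_integrable_cc => x.
  by apply: cvg_norm; exact: cd.
- apply: continuous_integrable_cc => x.
  by apply: cvgM; [exact: cvg_cst|exact: ca].
- move=> x _; rewrite -mulrBl normrM (ger0_norm (a0 x)) ler_wpM2r//.
  by apply: (le_trans (gL _ _ _ _)); rewrite subrr normr0 add0r.
Qed.

Lemma Rintegration_by_parts0 f f' a a' p r : p < r ->
  continuous f' -> (forall x : R, is_derive x 1 f (f' x)) ->
  continuous a' -> (forall x : R, is_derive x 1 a (a' x)) ->
  a p = 0 -> a r = 0 ->
  Rintegral mu `[p, r] (fun x => f x * a' x) =
  - Rintegral mu `[p, r] (fun x => f' x * a x).
Proof.
move=> pr cf' df ca' da ap ar.
rewrite (@Rintegration_by_parts _ f a f' a')// ?ap ?ar ?mulr0 ?subrr ?sub0r//.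
- exact: continuous_subspaceT.
- split.
  + by move=> x _; have := df x => ?; exact: ex_derive.
  + by apply: cvg_at_right_filter; exact: (is_derive_continuous (df p)).
  + by apply: cvg_at_left_filter; exact: (is_derive_continuous (df r)).
- by move=> x _; exact: is_derive_derive1 (df x).
- exact: continuous_subspaceT.
- split.
  + by move=> x _; have := da x => ?; exact: ex_derive.
  + by apply: cvg_at_right_filter; exact: (is_derive_continuous (da p)).
  + by apply: cvg_at_left_filter; exact: (is_derive_continuous (da r)).
- by move=> x _; exact: is_derive_derive1 (da x).
Qed.

Lemma near0_derive0 a (x d : R) : is_derive x 1 a d ->
  (\forall y \near x, a y = 0) -> d = 0.
Proof.
move=> da a0; rewrite -(is_derive_derive1 da).
apply: is_derive_derive1; apply: (near_eq_is_derive (f := cst 0)).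
by near=> y; apply/esym; near: y.
Unshelve. all: by end_near. Qed.

Lemma derive_support a a' p r : (forall x : R, is_derive x 1 a (a' x)) ->
  (forall x, a x != 0 -> p < x < r) -> forall x, a' x != 0 -> p <= x <= r.
Proof.
move=> da ap x; apply: contra_neqT; rewrite negb_and -!ltNge => /orP[xp|rx];
  apply: near0_derive0 (da x) _; near=> y.
- apply: contraPeq (_ : y < p) => [/ap/andP[py _]|]; first by apply/negP; rewrite -leNgt ltW.
  by near: y; exact: lt_nbhsl.
- apply: contraPeq (_ : r < y) => [/ap/andP[_ yr]|]; first by apply/negP; rewrite -leNgt ltW.
  by near: y; exact: lt_nbhsr.
Unshelve. all: by end_near. Qed.

Lemma bump_integral_gt0 c d : 0 < d -> 0 < Rintegral mu `[c - d, c + d] (bump c d).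
Proof.
move=> d0; have [a' _ da] := flat_generated_derive (bump_generated c d).
have ca : continuous (bump c d) by move=> x; exact: is_derive_continuous (da x).
(* Starting one unit before [c - d] makes the primitive differentiable at [c - d] too; it is then
   strictly increasing where the bump is positive. *)
pose B x := Rintegral mu `[c - d - 1, x] (bump c d).
have dB (x : R) : c - d <= x -> is_derive x 1 B (bump c d x).
  by move=> x1; apply: Rintegral_is_derive => //; lra.
have cB : {within `[c - d, c + d], continuous B}.
  apply: continuous_in_subspaceT => x; rewrite inE/= in_itv/= => /andP[x1 _].
  exact: is_derive_continuous (dB _ x1).
rewrite (_ : Rintegral _ _ _ = B (c + d) - B (c - d)).
  rewrite subr_gt0; apply: (@gtr0_derive1_incr _ B (c - d) (c + d)) => //; last lra.
  - move=> x; rewrite in_itv/= => /andP[x1 _]; have := dB _ (ltW x1) => ?.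
    exact: ex_derive.
  - move=> x; rewrite in_itv/= => x1; have /andP[/ltW x2 _] := x1.
    by rewrite (is_derive_derive1 (dB _ x2)) bump_gt0.
apply: Rintegral_FTC2 => //; first lra.
- exact: continuous_subspaceT.
- by move=> x /andP[/ltW x1 _]; exact: dB.
Qed.

End lipschitz2.

(** * From weak to classical solutions *)

Section nonlocal_flux.
Context {R : realType}.
Notation mu := (@lebesgue_measure R).
Implicit Types z t : R.
Variables K k : R -> R.
Hypothesis k_cont : continuous k.
Hypothesis k_ge0 : forall s : R, 0 <= k s.
Hypothesis K_cont : {within `[0, +oo[, continuous K}.
Hypothesis K_derive : forall s : R, 0 < s -> is_derive s 1 K (- k s).
Hypothesis K_int : mu.-integrable `[0, +oo[ (EFin \o K).
Hypothesis K_cvg : K x @[x --> +oo] --> 0.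
Variables (u : R -> R -> R) (L M : R) (q : R -> R) (C : R).
Hypothesis u_lip : lipschitz2 L u.
Hypothesis u_bnd : forall z t, 1 <= u z t <= M.
Hypothesis q_lip : forall a b, 1 <= a <= M -> 1 <= b <= M ->
  `|q b - q a| <= C * `|b - a|.

Let B := `|q 1| + `|C| * (M - 1).

Lemma flux_lipschitz2 : lipschitz2 (`|C| * L) (fun z t => q (u z t)).
Proof.
move=> z t z' t'; apply: (le_trans (q_lip (u_bnd _ _) (u_bnd _ _))).
apply: (le_trans (ler_wpM2r (normr_ge0 _) (ler_norm C))).
by rewrite -mulrA ler_wpM2l.
Qed.

Lemma flux_bounded z t : `|q (u z t)| <= B.
Proof.
have /andP[u1 uM] := u_bnd z t.
have h1 : 1 <= (1 : R) <= M by rewrite lexx (le_trans u1).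
rewrite -(subrK (q 1) (q _)) addrC (le_trans (ler_normD _ _))// lerD2l.
apply: (le_trans (q_lip h1 (u_bnd z t))).
apply: (le_trans (ler_wpM2r (normr_ge0 _) (ler_norm C))).
by rewrite ler_wpM2l// ger0_norm ?subr_ge0// lerD2r.
Qed.

Lemma flux_cont t : continuous (fun z => q (u z t)).
Proof. exact: continuous2_l (lipschitz2_continuous flux_lipschitz2) t. Qed.

Definition nonlocal_rate (z t : R) :=
  Rintegral mu `[0, +oo[ (fun s => k s * (q (u (z + s) t) - q (u z t))).

Lemma flux_average_is_derive z t :
  is_derive z 1 (fun z => Rintegral mu `[0, +oo[ (fun s => K s * q (u (z + s) t)))
    (nonlocal_rate z t).
Proof.
apply: (@average_is_derive _ K k _ _ _ _ _ _ (fun z => q (u z t)) B) => //.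
- exact: flux_cont.
- by move=> x; exact: flux_bounded.
Qed.

Lemma nonlocal_rate_integrable z t : mu.-integrable `[0, +oo[
  (EFin \o (fun s => k s * (q (u (z + s) t) - q (u z t)))).
Proof.
apply: (@integrable_mul_bounded _ _ _ (2 * B)).
- exact: (@k_integrable _ K).
- apply: continuous_subspaceT => s; apply: cvgB; last exact: cvg_cst.
  apply: (@continuous_comp _ _ _ (fun s => z + s) (fun x => q (u x t)));
    last exact: flux_cont.
  by apply: cvgD; [exact: cvg_cst|exact: cvg_id].
- move=> s _; rewrite (le_trans (ler_normB _ _))//.
  by rewrite (_ : 2 * B = B + B) ?lerD ?flux_bounded//; lra.
Qed.

(** [K 0] is the mass of [k], and the 2 counts the two flux values in the increment, each Lipschitz
    with constant [|C| * L]. *)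
Lemma nonlocal_rate_lipschitz2 :
  lipschitz2 (K 0 * (2 * (`|C| * L))) nonlocal_rate.
Proof.
move=> z t z' t'; rewrite -!mulrA.
apply: (k_Rintegral_lipschitz k_cont k_ge0 K_cont K_derive K_cvg);
  [exact: nonlocal_rate_integrable..|].
move=> s _; set D := `|z - z'| + `|t - t'|.
have h1 := flux_lipschitz2 z t z' t'.
have h2 := flux_lipschitz2 (z + s) t (z' + s) t'.
have zs : z + s - (z' + s) = z - z' by lra.
rewrite zs in h2; rewrite -/D in h1 h2.
rewrite (_ : _ - _ - _ = (q (u (z + s) t) - q (u (z' + s) t')) -
  (q (u z t) - q (u z' t'))); last by ring.
by apply: (le_trans (ler_normB _ _)); lra.
Qed.

End nonlocal_flux.

(** * Localising the weak formulation at a point *)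

Section weak_to_classical.
Context {R : realType}.
Notation mu := (@lebesgue_measure R).

Lemma Rintegral_le_cst (f : R -> R) (e T : R) : 0 <= T -> continuous f ->
  (forall t, 0 <= t <= T -> `|f t| <= e) -> `|Rintegral mu `[0, T] f| <= e * T.
Proof.
move=> T0 cf fe; apply: (le_trans (le_normr_Rintegral _ _)) => //.
  exact: continuous_integrable_cc.
apply: (@le_trans _ _ (Rintegral mu `[0, T] (cst e))).
  apply: le_Rintegral => //.
  - by apply: continuous_integrable_cc => x; apply: cvg_norm; exact: cf.
  - by apply: continuous_integrable_cc => x; exact: cvg_cst.
rewrite Rintegral_cst//= lebesgue_measure_itv/= lte_fin.
case: ltP => [_|T0']; first by rewrite oppr0 adde0.
by rewrite (_ : T = 0)//; apply/eqP; rewrite eq_le T0 T0'.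
Qed.

(* Testing with [t * a z] removes the initial datum and, letting the bump [a]
   concentrate at [c], yields [T u(c,T) = \int_0^T (u + t G)(c,t) dt]. *)
Lemma weak_is_classical (u A G : R -> R -> R) (L L' : R) :
  lipschitz2 L u -> lipschitz2 L' G ->
  (forall z t : R, is_derive z 1 (A ^~ t) (G z t)) ->
  (forall (a a' : R -> R) (p r T : R), flat_generated a ->
    (forall x, a x != 0 -> p < x < r) ->
    (forall x : R, is_derive x 1 a (a' x)) -> 0 < T ->
    Rintegral mu `[0, T] (fun t =>
      Rintegral mu setT (fun z => u z t * a z - A z t * (a' z * t))) =
    Rintegral mu setT (fun z => u z T * (a z * T))) ->
  forall c T : R, 0 < T -> is_derive T 1 (u c) (G c T).
Proof.
move=> uL GL dA weak c.
have L0 := lipschitz2_ge0 uL; have L'0 := lipschitz2_ge0 GL.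
have cu := lipschitz2_continuous uL; have cG := lipschitz2_continuous GL.
pose g t := u c t + t * G c t.
have cg : continuous g.
  move=> t; apply: cvgD; first exact: continuous2_r cu c t.
  by apply: cvgM; [exact: cvg_id|exact: continuous2_r cG c t].
(* Replacing bump averages by values at [c] costs [L * d] at time [T] and at most [(L + T * L') * d]
   under the time integral; both errors are multiplied by [T], and the mass [I] of the bump
   cancels. *)
have bound (T d : R) : 0 < T -> 0 < d ->
    `|T * u c T - Rintegral mu `[0, T] g| <= d * (T * (L + L + T * L')).
  move=> T0 d0; pose a := bump c d; pose p := c - d; pose r := c + d.
  have pr : p < r by rewrite /p /r; lra.
  have sa : flat_generated a by exact: bump_generated.
  have [a' sa' da] := flat_generated_derive sa.
  have [a'' _ da'] := flat_generated_derive sa'.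
  have ca : continuous a by move=> x; exact: is_derive_continuous (da x).
  have ca' : continuous a' by move=> x; exact: is_derive_continuous (da' x).
  have a0 x : 0 <= a x by exact: bump_ge0.
  have asupp x : a x != 0 -> p < x < r by exact: bump_support.
  have ap : a p = 0 by apply: contraPeq asupp => /[swap] /[apply]; rewrite ltxx.
  have ar : a r = 0.
    by apply: contraPeq asupp => /[swap] /[apply]; rewrite ltxx andbF.
  pose I := Rintegral mu `[p, r] a.
  have I0 : 0 < I by exact: bump_integral_gt0.
  pose mU t := Rintegral mu `[p, r] (fun z => u z t * a z).
  pose mG t := Rintegral mu `[p, r] (fun z => G z t * a z).
  have cmU : continuous mU by exact: weighted_Rintegral_continuous uL ca a0.
  have cmG : continuous mG by exact: weighted_Rintegral_continuous GL ca a0.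
  (* Integration by parts in space trades [A] and [a'] for [G] and [a], without boundary terms since
     the bump vanishes at [p] and [r]. *)
  have inner t : Rintegral mu setT (fun z => u z t * a z - A z t * (a' z * t)) =
      mU t + t * mG t.
    rewrite (@Rintegral_support _ _ p r); last first.
      move=> x; apply: contra_neqT => xpr.
      have -> : a x = 0.
        by apply: contraNeq xpr => /asupp /andP[px xr]; rewrite !ltW.
      have -> : a' x = 0.
        by apply: contraNeq xpr; exact: (derive_support da asupp).
      by rewrite mul0r !mulr0 subrr.
    have cA : continuous (A ^~ t) by move=> x; exact: is_derive_continuous (dA x t).
    have cAa : continuous (fun z => A z t * a' z).
      by move=> x; apply: cvgM; [exact: cA|exact: ca'].
    rewrite RintegralB//; [|apply: continuous_integrable_cc..]; last 2 first.
    - by move=> x; apply: cvgM; [exact: continuous2_l cu t x|exact: ca].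
    - move=> x; apply: cvgM; first exact: cA.
      by apply: cvgM; [exact: ca'|exact: cvg_cst].
    under [X in _ - X]eq_Rintegral do rewrite mulrA.
    rewrite RintegralZr//; last exact: continuous_integrable_cc.
    rewrite (@Rintegration_by_parts0 _ _ (G ^~ t) a a')//.
    - by rewrite mulNr opprK mulrC.
    - exact: continuous2_l cG t.
  have := weak a a' p r T sa asupp da T0.
  under eq_Rintegral do rewrite inner.
  rewrite (@Rintegral_support _ _ p r); last first.
    move=> x; apply: contra_neqT => xpr.
    have -> : a x = 0.
      by apply: contraNeq xpr => /asupp /andP[px xr]; rewrite !ltW.
    by rewrite mul0r mulr0.
  under [RHS]eq_Rintegral do rewrite mulrA.
  rewrite RintegralZr//; last first.
    apply: continuous_integrable_cc => x.
    by apply: cvgM; [exact: continuous2_l cu T x|exact: ca].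
  rewrite -/(mU T) => weakT.
  have near_c x : p <= x <= r -> `|x - c| <= d.
    by rewrite /p /r ler_norml => /andP[? ?]; lra.
  have E1 t : `|mU t - u c t * I| <= L * d * I.
    apply: weighted_Rintegral_close => //; first exact: continuous2_l cu t.
    move=> x /near_c xc; apply: (le_trans (uL _ _ _ _)).
    by rewrite subrr normr0 addr0 ler_wpM2l.
  have E2 t : `|mG t - G c t * I| <= L' * d * I.
    apply: weighted_Rintegral_close => //; first exact: continuous2_l cG t.
    move=> x /near_c xc; apply: (le_trans (GL _ _ _ _)).
    by rewrite subrr normr0 addr0 ler_wpM2l.
  have cm : continuous (fun t => mU t + t * mG t).
    by move=> t; apply: cvgD; [exact: cmU|apply: cvgM; [exact: cvg_id|exact: cmG]].
  have cgI : continuous (fun t => g t * I).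
    by move=> t; apply: cvgM; [exact: cg|exact: cvg_cst].
  have E3 : `|Rintegral mu `[0, T] (fun t => mU t + t * mG t) -
      Rintegral mu `[0, T] g * I| <= (L * d * I + T * (L' * d * I)) * T.
    rewrite -RintegralZr//; last exact: continuous_integrable_cc.
    rewrite -RintegralB//; [|exact: continuous_integrable_cc..].
    apply: Rintegral_le_cst; first exact: ltW.
      by move=> t; apply: cvgB; [exact: cm|exact: cgI].
    move=> t /andP[t0 tT].
    rewrite (_ : _ - _ = (mU t - u c t * I) + t * (mG t - G c t * I)); last first.
      by rewrite /g; ring.
    apply: (le_trans (ler_normD _ _)); apply: lerD => //.
    rewrite normrM (ger0_norm t0); apply: ler_pM => //; exact: E2.
  rewrite weakT in E3; rewrite -(ler_pM2r I0) -[X in _ * X <= _](gtr0_norm I0) -normrM.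
  rewrite (_ : _ * I = (mU T * T - Rintegral mu `[0, T] g * I) -
    T * (mU T - u c T * I)); last by ring.
  apply: (le_trans (ler_normB _ _)).
  have := E1 T; rewrite -(ler_pM2l T0) -{1}(gtr0_norm T0) -normrM => E1T.
  apply: (le_trans (lerD E3 E1T)).
  by rewrite le_eqVlt; apply/orP; left; apply/eqP; ring.
have key (T : R) : 0 < T -> Rintegral mu `[0, T] g = T * u c T.
  move=> T0; apply/esym/eqP; rewrite -subr_eq0 -normr_le0.
  apply/ler_addgt0Pr => e e0; rewrite add0r.
  set N := T * (L + L + T * L').
  have N0 : 0 <= N by have := ltW T0 => ?; rewrite /N !(mulr_ge0, addr_ge0).
  have d0 : 0 < e / (N + 1) by rewrite divr_gt0// ltr_wpDl.
  apply: (le_trans (bound _ _ T0 d0)).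
  by rewrite -/N -mulrA ger_pMr// mulrC ler_pdivrMr ?mul1r ?lerDl// ltr_wpDl.
move=> T T0; have T_neq0 : T != 0 by rewrite gt_eqF.
(* Near [T], [u c] equals the mean of the continuous [g] over [[0, x]], hence is differentiable; the
   quotient rule gives [(g T - u c T) / T = G c T]. *)
apply: (near_eq_is_derive (f := fun x : R => Rintegral mu `[0, x] g * x^-1)).
  near=> x; have x0 : 0 < x by near: x; exact: lt_nbhsr.
  by rewrite key// mulrAC divff ?mul1r// gt_eqF.
have dV : is_derive T 1 (fun y : R => y^-1) (- T ^- 2).
  by rewrite -[- _]mulr1; exact: (@is_deriveV _ id).
have := is_deriveM (Rintegral_is_derive cg T0) dV => /is_derive_eq; apply.
by rewrite key// /GRing.scale/= /g; field.
Unshelve. all: by end_near. Qed.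

End weak_to_classical.

(** * The entropy balance in weak form *)

Section weak_entropy.
Context {R : realType}.
Notation mu := (@lebesgue_measure R).
Implicit Types (z t : R).

Lemma continuous2M (f g : R -> R -> R) :
  continuous (fun x : R * R => f x.1 x.2) ->
  continuous (fun x : R * R => g x.1 x.2) ->
  continuous (fun x : R * R => f x.1 x.2 * g x.1 x.2).
Proof. by move=> cf cg x; apply: cvgM; [exact: cf|exact: cg]. Qed.

Lemma rectangle_bounded (f : R -> R -> R) (a b c d : R) : a <= b -> c <= d ->
  continuous (fun x : R * R => f x.1 x.2) ->
  exists2 C, 0 <= C & forall z t, a <= z <= b -> c <= t <= d -> `|f z t| <= C.
Proof.
move=> ab cd cf.
have [] := @compact_EVT_max _ _ (fun x : R * R => `|f x.1 x.2|) (`[a, b] `*` `[c, d]).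
- by exists (a, c); split; rewrite /= in_itv/= lexx ?ab ?cd.
- by apply: compact_setX; exact: segment_compact.
- by apply: continuous_subspaceT => x; apply: cvg_norm; exact: cf.
move=> m _ fm; exists `|f m.1 m.2| => // z t zab tcd.
by apply: (fm (z, t)); rewrite inE; split; rewrite /= in_itv.
Qed.

Variables (E E' A G phi : R -> R -> R).
Hypothesis E_cont : continuous (fun x : R * R => E x.1 x.2).
Hypothesis E'_cont : continuous (fun x : R * R => E' x.1 x.2).
Hypothesis G_cont : continuous (fun x : R * R => G x.1 x.2).
Hypothesis E_derive : forall z t, 0 < t -> is_derive t 1 (E z) (E' z t).
Hypothesis A_derive : forall z t, is_derive z 1 (A ^~ t) (G z t).
Hypothesis phi_test : test_fun_open phi.

Let phi_smooth : smooth2 phi. Proof. by case: phi_test. Qed.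

Let phi_cont : continuous (fun x : R * R => phi x.1 x.2).
Proof. by have [] := phi_smooth [::]. Qed.

Let phiz_cont : continuous (fun x : R * R => dz phi x.1 x.2).
Proof. by have [] := phi_smooth [:: true]. Qed.

Let phit_cont : continuous (fun x : R * R => dt phi x.1 x.2).
Proof. by have [] := phi_smooth [:: false]. Qed.

Let phiz_derive z t : is_derive z 1 (phi ^~ t) (dz phi z t).
Proof.
by have [_ /(_ z t)[d _]] := phi_smooth [::]; exact: derivable_is_derive1 d.
Qed.

Let phit_derive z t : is_derive t 1 (phi z) (dt phi z t).
Proof.
by have [_ /(_ z t)[_ d]] := phi_smooth [::]; exact: derivable_is_derive1 d.
Qed.

Let P z t := E z t * dt phi z t + E' z t * phi z t.

Let P_cont : continuous (fun x : R * R => P x.1 x.2).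
Proof. by move=> x; apply: cvgD; exact: continuous2M. Qed.

Let Ephi_derive z t : 0 < t -> is_derive t 1 (fun t => E z t * phi z t) (P z t).
Proof.
move=> t0; have := is_deriveM (E_derive z t0) (phit_derive z t).
by move=> /is_derive_eq; apply; rewrite /P /GRing.scale/= [phi _ _ * _]mulrC.
Qed.

(** Moving the [z]-derivative from [phi] onto [A] produces a term that cancels [G * phi]; what
    remains is [P], the time derivative of [E * phi]. *)
Lemma spatial_by_parts (N t : R) : 0 < N ->
  (forall z t, phi z t != 0 -> - N < z < N) ->
  Rintegral mu setT (fun z => E z t * dt phi z t
    - (G z t - E' z t) * phi z t - A z t * dz phi z t) =
  Rintegral mu `[- N, N] (P ^~ t).
Proof.
move=> N0 supp.
have phi0 z s : ~~ (- N <= z <= N) -> phi z s = 0.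
  by apply: contraNeq => /supp /andP[? ?]; rewrite !ltW.
have pN s : phi N s = 0.
  by apply: contraPeq (@supp N s) => /[swap] /[apply]; rewrite ltxx andbF.
have pmN s : phi (- N) s = 0.
  by apply: contraPeq (@supp (- N) s) => /[swap] /[apply]; rewrite ltxx.
rewrite (@Rintegral_support _ _ (- N) N); last first.
  move=> z; apply: contra_neqT => zN; rewrite phi0//.
  have -> : dt phi z t = 0.
    have phi_near : \forall s \near t, phi z s = 0 by near=> s; exact: phi0.
    exact: near0_derive0 (phit_derive z t) phi_near.
  have -> : dz phi z t = 0.
    apply: contraNeq zN.
    by apply: (derive_support (phiz_derive ^~ t)) => x; exact: supp.
  by rewrite !mulr0 !subr0.
have cA : continuous (A ^~ t) by move=> z; exact: is_derive_continuous (A_derive z t).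
have cp : continuous (phi ^~ t) by exact: continuous2_l.
have cpz : continuous (dz phi ^~ t) by exact: continuous2_l.
have cG : continuous (G ^~ t) by exact: continuous2_l.
have cP : continuous (P ^~ t) by exact: continuous2_l.
have cGp : continuous (fun z => G z t * phi z t).
  by move=> z; apply: cvgM; [exact: cG|exact: cp].
have cAp : continuous (fun z => A z t * dz phi z t).
  by move=> z; apply: cvgM; [exact: cA|exact: cpz].
transitivity (Rintegral mu `[- N, N] (fun z => P z t - G z t * phi z t - A z t * dz phi z t)).
  by apply: eq_Rintegral => z _; rewrite /P; ring.
rewrite RintegralB//; [|apply: continuous_integrable_cc..] => //; last first.
  by move=> z; apply: cvgB; [exact: cP|exact: cGp].
rewrite RintegralB//; [|exact: continuous_integrable_cc..].
have NN : - N < N by rewrite gtrN.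
have dA z : is_derive z 1 (A ^~ t) (G z t) by exact: A_derive.
have dphi z : is_derive z 1 (phi ^~ t) (dz phi z t) by exact: phiz_derive.
have -> : Rintegral mu `[- N, N] (fun z => A z t * dz phi z t) = _ :=
  Rintegration_by_parts0 NN cG dA cpz dphi (pmN t) (pN t).
by rewrite opprK subrK.
Unshelve. all: by end_near. Qed.

(** The inner integral is the time derivative of [J], and [J] vanishes at both ends of a window
    [[e, T]] outside which [J'] is zero. *)
Lemma weak_entropy_balance :
  Rintegral mu `]0, +oo[ (fun t => Rintegral mu setT (fun z =>
    E z t * dt phi z t - (G z t - E' z t) * phi z t - A z t * dz phi z t)) = 0.
Proof.
have [_ [M [eps [eps0 phi0]]]] := phi_test.
pose N := `|M| + 1; pose e := eps / 2; pose T := `|M| + eps + 1.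
have MM := ler_norm M; have M0 := normr_ge0 M.
have N0 : 0 < N by rewrite /N; lra.
have e0 : 0 < e by rewrite /e; lra.
have eT : e < T by rewrite /e /T; lra.
have supp z t : phi z t != 0 -> - N < z < N.
  apply: contraNT => zN; apply/eqP/phi0; left; rewrite ltNge.
  apply: contra zN; rewrite ler_norml => /andP[]; rewrite /N; lra.
under eq_Rintegral do rewrite (spatial_by_parts _ N0 supp).
pose J' t := Rintegral mu `[- N, N] (P ^~ t).
pose J t := Rintegral mu `[- N, N] (fun z => E z t * phi z t).
have phit0 z t : t < eps \/ M < t -> dt phi z t = 0.
  move=> tt; have phi_near : \forall s \near t, phi z s = 0.
    case: tt => tt; near=> s; apply: phi0; right; [left|right]; near: s.
      exact: lt_nbhsl.
    exact: lt_nbhsr.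
  exact: near0_derive0 (phit_derive z t) phi_near.
have P0 z t : t < eps \/ M < t -> P z t = 0.
  by move=> tt; rewrite /P phit0// phi0 ?mulr0 ?addr0//; right.
have J'0 t : t < eps \/ M < t -> J' t = 0.
  move=> tt; rewrite /J' (@eq_Rintegral _ _ _ _ _ (cst 0)); last by move=> z _; exact: P0.
  by rewrite Rintegral_cst// mul0r.
have J0 t : t < eps \/ M < t -> J t = 0.
  move=> tt; rewrite /J (@eq_Rintegral _ _ _ _ _ (cst 0)); last first.
    by move=> z _; rewrite phi0 ?mulr0//; right.
  by rewrite Rintegral_cst// mul0r.
rewrite Rintegral_mkcond (@Rintegral_support _ _ e T); last first.
  move=> t; rewrite patchE; case: ifPn => [_|_]; last by rewrite eqxx.
  apply: contraNT; rewrite negb_and -!ltNge => tt; apply/eqP/J'0.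
  by move: tt; rewrite /e /T => /orP[tt|tt]; [left|right]; lra.
transitivity (Rintegral mu `[e, T] J').
  apply: eq_Rintegral => t; rewrite inE/= in_itv/= => /andP[et _].
  by rewrite patchE mem_set//= in_itv/= (lt_le_trans e0 et).
have NN : - N <= N by lra.
have eT' : e / 2 <= T + 1 by lra.
(* Differentiation under the integral needs an open interval around [[e, T]]; []e / 2, T + 1[] still
   lies in [t > 0], where [E] is differentiable in time, and [C] dominates [P] on its closure. *)
have [C C0 PC] := rectangle_bounded NN eT' P_cont.
pose f t z := E z t * phi z t.
have Ipos t : `]e / 2, T + 1[%classic t -> [/\ 0 < t & e / 2 <= t <= T + 1].
  by rewrite /= in_itv/= => /andP[? ?]; split; lra.
have fint t : mu.-integrable `[- N, N] (EFin \o f t).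
  apply: continuous_integrable_cc => z.
  by apply: cvgM; [exact: continuous2_l E_cont t z|exact: continuous2_l phi_cont t z].
have i1 t : `]e / 2, T + 1[%classic t -> mu.-integrable `[- N, N] (EFin \o f t).
  by move=> _; exact: fint.
have i2 t z : `]e / 2, T + 1[%classic t -> `[- N, N]%classic z ->
    derivable (f ^~ z) t 1.
  by move=> /Ipos[t0 _] _; have := Ephi_derive z t0 => ?; exact: ex_derive.
have i3 : forall z : R, 0 <= cst C z by [].
have i4 : mu.-integrable `[- N, N] (EFin \o cst C).
  by apply: continuous_integrable_cc => z; exact: cvg_cst.
have partialE t z : `]e / 2, T + 1[%classic t -> partial1of2 f t z = P z t.
  by move=> /Ipos[t0 _]; exact: is_derive_derive1 (Ephi_derive z t0).
have i5 t z : `]e / 2, T + 1[%classic t -> `[- N, N]%classic z ->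
    `|partial1of2 f t z| <= cst C z.
  move=> tI; rewrite partialE//= in_itv/= => zN; apply: PC => //.
  by have [] := Ipos _ tI.
have dJ t : `]e / 2, T + 1[%classic t -> is_derive t 1 J (J' t).
  move=> tI.
  have d := @derivable_under_integral _ _ _ mu _ _ (measurable_itv _)
    t _ _ tI i1 i2 (cst C) i3 i4 i5.
  have v := @differentiation_under_integral _ _ _ mu _ _ (measurable_itv _)
    t _ _ tI i1 i2 (cst C) i3 i4 i5.
  have := derivable_is_derive1 d => /is_derive_eq; apply; rewrite v.
  by apply: eq_Rintegral => z _; exact: partialE.
have cJ' : {in `]e / 2, T + 1[%classic, continuous J'}.
  apply: (@continuity_under_integral _ _ _ mu (fun t z => P z t) _ (measurable_itv _)
    _ _ _ _ (cst C)) => //.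
  - move=> t _; apply: continuous_integrable_cc; exact: continuous2_l P_cont t.
  - by apply: aeW => z _ t _; exact: continuous2_r P_cont z t.
  - move=> t /Ipos[_ tI]; apply: aeW => z; rewrite /= in_itv/= => zN.
    exact: PC.
have sub t : e <= t <= T -> `]e / 2, T + 1[%classic t.
  by move=> /andP[? ?]; rewrite /= in_itv/=; lra.
rewrite (_ : Rintegral _ _ _ = J T - J e).
  rewrite !J0 ?subrr//; first by left; rewrite /e; lra.
  by right; rewrite /T; lra.
apply: Rintegral_FTC2; first exact: ltW.
- apply: continuous_in_subspaceT => t; rewrite inE/= in_itv/= => /sub tI.
  by apply: cJ'; rewrite inE.
- apply: continuous_in_subspaceT => t; rewrite inE/= in_itv/= => /sub tI.
  exact: is_derive_continuous (dJ _ tI).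
- by move=> t /andP[? ?]; apply: dJ; apply: sub; rewrite !ltW.
Unshelve. all: by end_near. Qed.

End weak_entropy.

(** * The entropy balance *)

Section assembly.
Context {R : realType}.
Notation mu := (@lebesgue_measure R).

(* The hypotheses only constrain [w] for [t >= 0]; reflecting in time makes it
   Lipschitz on the whole plane. *)
Lemma reflect_lipschitz2 (w : R -> R -> R) (L : R) :
  (forall z t z' t', 0 <= t -> 0 <= t' ->
    `|w z t - w z' t'| <= L * (`|z - z'| + `|t - t'|)) ->
  lipschitz2 `|L| (fun z t => w z `|t|).
Proof.
move=> wL z t z' t'; apply: (le_trans (wL _ _ _ _ _ _)) => //.
apply: (@le_trans _ _ (`|L| * (`|z - z'| + `| `|t| - `|t'| |))).
  by rewrite ler_wpM2r ?ler_norm// addr_ge0.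
by rewrite ler_wpM2l// lerD2l ler_dist_dist.
Qed.

(** The time factor is spelled [0 + 1 * t] to match the affine shape for which smoothness is
    known. *)
Lemma tensor_test_fun (a : R -> R) (p r T : R) : flat_generated a ->
  (forall x, a x != 0 -> p < x < r) ->
  test_fun T (fun z t => a z * (0 + 1 * t)).
Proof.
move=> sa supp; split; first exact: tensor_smooth2.
exists (`|p| + `|r|) => z t zpr.
suff -> : a z = 0 by rewrite mul0r.
apply: contraPeq zpr => /supp /andP[pz zr]; apply/negP; rewrite -leNgt.
have := ler_norm r; have := ler_norm (- p); rewrite normrN => ? ?.
by have := normr_ge0 p; have := normr_ge0 r; rewrite ler_norml; lra.
Qed.

Lemma weak_solution_tensor (Phi W w0 : R -> R) (alpha : R) (w : R -> R -> R)
    (a a' : R -> R) (p r T : R) :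
  weak_solution Phi alpha W w w0 -> flat_generated a ->
  (forall x, a x != 0 -> p < x < r) ->
  (forall x : R, is_derive x 1 a (a' x)) -> 0 < T ->
  Rintegral mu `[0, T] (fun t => Rintegral mu setT (fun z =>
    w z t * a z - avg Phi alpha (fun x => W (w x t)) z * (a' z * t))) =
  Rintegral mu setT (fun z => w z T * (a z * T)).
Proof.
move=> weak sa supp da T0; have := weak _ T0 _ (tensor_test_fun T sa supp).
have dtE z t : dt (fun z t => a z * (0 + 1 * t)) z t = a z.
  apply: is_derive_derive1.
  have := is_deriveZ (a z) (affine_is_derive 0 1 t) => /is_derive_eq; apply.
  by rewrite /GRing.scale/= mulr1.
have dzE z t : dz (fun z t => a z * (0 + 1 * t)) z t = a' z * t.
  apply: is_derive_derive1.
  have := is_deriveM (da z) (is_derive_cst (0 + 1 * t) z (1 : R)).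
  by move=> /is_derive_eq; apply; rewrite /GRing.scale/=; ring.
under eq_Rintegral => t _.
  under eq_Rintegral => z _ do rewrite dtE dzE.
  over.
move=> ->; apply: eq_Rintegral => z _.
by rewrite add0r mul1r add0r !mulr0 subr0.
Qed.

(* At [s = 0] the two-sided derivative of [Phi_a] is a junk value, but the double
   integral vanishes there. *)
Lemma Dterm_eq (Phi V eta Q k : R -> R) (alpha : R) (w : R -> R -> R) (z t : R) :
  C1_nonneg V -> (forall x y, 0 <= x -> x <= y -> V y <= V x) ->
  C2 eta -> {within `[1, +oo[, continuous Q} ->
  (forall x : R, 1 < x ->
     is_derive x (1 : R) Q (derive1 eta x * derive1 (Wof V) x)) ->
  (forall s : R, 0 < s -> is_derive s 1 (Phi_a Phi alpha) (- k s)) ->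
  (forall x, 1 <= w x t) ->
  Dterm Phi alpha (Wof V) eta w z t =
  Rintegral mu `[0, +oo[ (fun s => k s *
    (Q (w (z + s) t) - Q (w z t) -
     derive1 eta (w z t) * (Wof V (w (z + s) t) - Wof V (w z t)))).
Proof.
move=> V_C1 V_nincr eta_C2 Q_cont Q_derive K_derive w1.
apply: eq_Rintegral => s; rewrite inE/= in_itv/= andbT.
rewrite (oint_dissipation V_C1 V_nincr eta_C2 Q_cont Q_derive)//.
rewrite le_eqVlt => /predU1P[<-|s0]; last first.
  by rewrite (is_derive_derive1 (K_derive _ s0)) opprK.
by rewrite addr0 !subrr mulr0 subrr !mulr0.
Qed.

End assembly.

Theorem theorem5p1 (R : realType) (Phi V : R -> R) (alpha : R) (y0 : R -> R)
    (w : R -> R -> R) (eta Q : R -> R) :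
  (* standing assumptions on the kernel Phi *)
  (forall z : R, 0 <= z -> 0 <= Phi z) ->
  (forall x y : R, 0 <= x -> x <= y -> Phi y <= Phi x) ->
  (\int[@leb R]_(z in `[0%R, +oo[) (Phi z)%:E = 1)%E ->
  (\int[@leb R]_(z in `[0%R, +oo[) (z * Phi z)%:E < +oo)%E ->
  (* additional assumption Phi in C^1([0,oo)) *)
  C1_nonneg Phi ->
  (* flux: V in C^1([0,oo)) non-increasing, W(w) = V(1/w) *)
  C1_nonneg V ->
  (forall x y : R, 0 <= x -> x <= y -> V y <= V x) ->
  0 < alpha ->
  (* initial datum *)
  BV y0 -> (forall z : R, 1 <= y0 z) ->
  (* w_alpha : bounded, Lipschitz, values in [1,oo), weak solution *)
  (exists M : R, forall z t : R, 0 <= t -> `|w z t| <= M) ->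
  (exists L : R, forall z t z' t' : R, 0 <= t -> 0 <= t' ->
      `|w z t - w z' t'| <= L * (`|z - z'| + `|t - t'|)) ->
  (forall z t : R, 0 <= t -> 1 <= w z t) ->
  weak_solution Phi alpha (Wof V) w (avg Phi alpha y0) ->
  (* entropy pair *)
  C2 eta -> convex_fun eta ->
  {within `[1, +oo[, continuous Q} ->
  (forall x : R, 1 < x ->
     is_derive x (1 : R) Q (derive1 eta x * derive1 (Wof V) x)) ->
  (* conclusion *)
  (forall z t : R, 0 <= t -> 0 <= Dterm Phi alpha (Wof V) eta w z t) /\
  (forall phi : R -> R -> R, test_fun_open phi ->
     Rintegral (@leb R) `]0, +oo[ (fun t => Rintegral (@leb R) setT (fun z =>
        eta (w z t) * dt phi z t
        - Dterm Phi alpha (Wof V) eta w z t * phi z t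
        - avg Phi alpha (fun x => Q (w x t)) z * dz phi z t)) = 0) /\
  {ae ((@leb R) \x (@leb R))%E, forall p : R * R, 0 < p.2 ->
     [/\ derivable (fun s => eta (w p.1 s)) p.2 (1 : R),
         derivable (fun x => avg Phi alpha (fun y => Q (w y p.2)) x) p.1 (1 : R) &
         dt (fun z t => eta (w z t)) p.1 p.2
         + Dterm Phi alpha (Wof V) eta w p.1 p.2
         = dz (fun z t => avg Phi alpha (fun y => Q (w y t)) z) p.1 p.2]}.
Proof.
move=> Phi_ge0 Phi_nincr Phi_int _ Phi_C1 V_C1 V_nincr alpha0 _ _ [M w_bnd].
move=> [L w_lip] w_ge1 weak eta_C2 eta_convex Q_cont Q_derive.
have [k [k_cont k_ge0 K_derive [K_cont K_int K_cvg]]] :=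
  Phi_a_kernel Phi_ge0 Phi_nincr Phi_int Phi_C1 alpha0.
set K := Phi_a Phi alpha in K_derive K_cont K_int K_cvg.
set W := Wof V in weak Q_derive *.
pose u (z t : R) := w z `|t|.
have uE (z t : R) : 0 <= t -> u z t = w z t by move=> t0; rewrite /u ger0_norm.
have u_lip : lipschitz2 `|L| u by exact: reflect_lipschitz2.
have u_bnd (z t : R) : 1 <= u z t <= M.
  by rewrite /u w_ge1//= (le_trans (ler_norm _))// w_bnd.
have W_cont : {within `[1, +oo[, continuous W} by exact: (Wof_cont V_C1 V_nincr).
have x0 (x : R) : 1 <= x -> 0 < x :> R by exact: lt_le_trans.
have W'_cont (x : R) : 1 <= x -> {for x, continuous (derive1 W)}.
  by move=> /x0 /(Wof_facts V_C1 V_nincr)[].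
have W_derive (x : R) : 1 < x -> is_derive x 1 W (derive1 W x).
  by move=> /ltW /x0 /(Wof_facts V_C1 V_nincr)[].
have eta'_cont : continuous (derive1 eta) by move=> x; have [] := C2_facts eta_C2 x.
have eta_derive (x : R) : is_derive x 1 eta (derive1 eta x).
  by have [] := C2_facts eta_C2 x.
have eta_cont : continuous eta by move=> x; exact: is_derive_continuous (eta_derive x).
have Q'_cont (x : R) : 1 <= x -> {for x, continuous (fun x => derive1 eta x * derive1 W x)}.
  by move=> x1; apply: cvgM; [exact: eta'_cont|exact: W'_cont].
have [CW W_lip] := lipschitz_bounded_derive M W_cont W'_cont W_derive.
have [CQ Q_lip] := lipschitz_bounded_derive M Q_cont Q'_cont Q_derive.
pose A (q : R -> R) (z t : R) :=
  Rintegral (@lebesgue_measure R) `[0, +oo[ (fun s => K s * q (u (z + s) t)).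
have avgE (q : R -> R) (z t : R) : 0 <= t -> avg Phi alpha (fun x => q (w x t)) z = A q z t.
  by move=> t0; rewrite /A; apply: eq_Rintegral => s _; rewrite uE.
have AW (z t : R) := flux_average_is_derive k_cont k_ge0 K_cont K_derive K_int K_cvg
  u_lip u_bnd W_lip z t.
have AQ (z t : R) := flux_average_is_derive k_cont k_ge0 K_cont K_derive K_int K_cvg
  u_lip u_bnd Q_lip z t.
set GW := nonlocal_rate k u W in AW; set GQ := nonlocal_rate k u Q in AQ.
have GW_lip := nonlocal_rate_lipschitz2 k_cont k_ge0 K_cont K_derive K_cvg
  u_lip u_bnd W_lip.
have GQ_lip := nonlocal_rate_lipschitz2 k_cont k_ge0 K_cont K_derive K_cvg
  u_lip u_bnd Q_lip.
have u_derive (z t : R) : 0 < t -> is_derive t 1 (u z) (GW z t).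
  apply: (weak_is_classical u_lip GW_lip AW) => a a' p r T sa supp da T0.
  under [RHS]eq_Rintegral do rewrite uE ?(ltW T0)//.
  rewrite -(weak_solution_tensor weak sa supp da T0).
  apply: eq_Rintegral => s; rewrite inE/= in_itv/= => /andP[s0 _].
  by apply: eq_Rintegral => x _; rewrite uE// avgE.
have DE (z t : R) : 0 <= t ->
    Dterm Phi alpha W eta w z t = GQ z t - derive1 eta (u z t) * GW z t.
  move=> t0; rewrite (Dterm_eq z V_C1 V_nincr eta_C2 Q_cont Q_derive K_derive);
    last by move=> x; exact: w_ge1.
  have iW := nonlocal_rate_integrable k_cont k_ge0 K_cont K_derive K_cvg
    u_lip u_bnd W_lip z t.
  have iQ := nonlocal_rate_integrable k_cont k_ge0 K_cont K_derive K_cvg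
    u_lip u_bnd Q_lip z t.
  rewrite /GW /GQ /nonlocal_rate -RintegralZl// -RintegralB//; last first.
    under [EFin \o _]eq_fun do rewrite /= EFinM.
    exact: integrableZl.
  by apply: eq_Rintegral => s _; rewrite -/W !uE//; ring.
pose E (z t : R) := eta (u z t).
pose E' (z t : R) := derive1 eta (u z t) * GW z t.
have E_derive (z t : R) : 0 < t -> is_derive t 1 (E z) (E' z t).
  move=> t0; exact: (@is_derive1_comp _ eta (u z) _ _ _ (eta_derive _) (u_derive z t t0)).
have u_cont := lipschitz2_continuous u_lip.
have GW_cont := lipschitz2_continuous GW_lip.
have GQ_cont := lipschitz2_continuous GQ_lip.
have E_cont : continuous (fun x : R * R => E x.1 x.2).
  move=> x; apply: (@continuous_comp _ _ _ (fun x : R * R => u x.1 x.2) eta).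
    exact: u_cont.
  exact: eta_cont.
have E'_cont : continuous (fun x : R * R => E' x.1 x.2).
  apply: (@continuous2M _ (fun z t => derive1 eta (u z t)) GW) => // x.
  apply: (@continuous_comp _ _ _ (fun x : R * R => u x.1 x.2) (derive1 eta)).
    exact: u_cont.
  exact: eta'_cont.
split; [|split].
- move=> z t t0.
  rewrite (Dterm_eq z V_C1 V_nincr eta_C2 Q_cont Q_derive K_derive);
    last by move=> x; exact: w_ge1.
  apply: Rintegral_ge0 => s _; apply: mulr_ge0 => //.
  by apply: dissipation_ge0 => //; exact: w_ge1.
- move=> phi phi_test.
  (* By [DE] the dissipation is [GQ - E'], so the integrands agree for [t > 0], where [u] and [w]
     coincide. *)
  apply: etrans (weak_entropy_balance E_cont E'_cont GQ_cont E_derive AQ phi_test).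
  apply: eq_Rintegral => t; rewrite inE/= in_itv/= andbT => /ltW t0.
  by apply: eq_Rintegral => z _; rewrite DE// avgE// -uE.
- apply: aeW => -[z t] /= t0.
  have d1 : is_derive t 1 (fun s => eta (w z s)) (E' z t).
    (* A two-sided time derivative needs [u] and [w] to agree on a neighbourhood of [t], which
       [t > 0] provides. *)
    apply: (near_eq_is_derive (f := E z)); last exact: E_derive.
    near=> s; rewrite /E uE//; apply: ltW; near: s; exact: lt_nbhsr.
  have d2 : is_derive z 1 (fun x => avg Phi alpha (fun y => Q (w y t)) x) (GQ z t).
    rewrite (_ : (fun x => avg _ _ _ x) = A Q ^~ t); first exact: AQ.
    by apply/funext => x; rewrite avgE// ltW.
  split; [exact: ex_derive|exact: ex_derive|].
  by rewrite /dt /dz (is_derive_derive1 d1) (is_derive_derive1 d2) DE ?ltW// addrC subrK.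
Unshelve. all: by end_near. Qed.
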